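(* Let $s\ge 2$ be an integer and let $Q^*=(q_{ik})_{0\le i\le s-1,\ k\in\mathbb{N}}$ be a matrix with $q_{ik}>0$, $\sum_{i=0}^{s-1}q_{ik}=1$ for every $k\in\mathbb{N}$, and $\prod_{k=1}^{\infty}\max_{i}q_{ik}=0$. Let $\{\xi_k\}_{k\ge1}$ be a sequence of independent random variables, $\xi_k$ taking the values $0,1,\dots,s-1$ with probabilities $p_{0k},p_{1k},\dots,p_{(s-1)k}$ respectively, where $p_{ik}\ge0$ and $\sum_{i=0}^{s-1} p_{ik}=1$. Let $\xi=\varDelta^{Q^*}_{\xi_1\xi_2\dots\xi_k\dots}$ be the corresponding random variable with independent $Q^*$-symbols, and let $\nu_\xi$ be its distribution on $[0,1]$. Put $$h_j:=-\sum_{i=0}^{s-1}p_{ij}\ln p_{ij}\ \ (0\ln 0:=0),\qquad H_n:=\sum_{j=1}^n h_j,$$ $$b_j:=-\sum_{i=0}^{s-1}p_{ij}\ln q_{ij},\qquad B_n:=\sum_{j=1}^n b_j,\qquad d_j:=-b_j^2+\sum_{i=0}^{s-1}p_{ij}\ln^2 q_{ij},$$ and, with $q_k:=\max_{0\le i\le s-1}q_{ik}$, $$S(\delta):=\sup_{m\ge0}\ \sum_{k=1}^{\infty}\left(\prod_{i=m+1}^{m+k}q_i\right)^{\delta}\qquad(\delta>0).$$ Assume that the following three conditions hold: $$S(\delta)<+\infty\ \text{ for every }\delta>0;\qquad \sum_{j=1}^{\infty}\frac{d_j}{j^2}<+\infty;\qquad \liminf_{n\to\infty}\frac{B_n}{n}>0.$$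 Then the Hausdorff dimension of the distribution of $\xi$ is $$\dim_H\nu_\xi=\liminf_{n\to\infty}\frac{H_n}{B_n}.$$
   Context: $\mathbb{N}=\{1,2,3,\dots\}$. Cylinders of the $Q^*$-expansion: for $n\ge1$ and $\alpha_1,\dots,\alpha_n\in\{0,\dots,s-1\}$, the cylinder $\varDelta_{\alpha_1\dots\alpha_n}$ of rank $n$ is the closed interval defined recursively as follows. $[0,1]$ is divided, from left to right, into $s$ consecutive closed intervals $\varDelta_0,\dots,\varDelta_{s-1}$ (adjacent ones sharing an endpoint) with lengths $|\varDelta_i|=q_{i1}$; each cylinder $\varDelta_{\alpha_1\dots\alpha_n}$ of rank $n$ is divided, from left to right, into $s$ consecutive closed intervals $\varDelta_{\alpha_1\dots\alpha_n 0},\dots,\varDelta_{\alpha_1\dots\alpha_n(s-1)}$ with $|\varDelta_{\alpha_1\dots\alpha_n i}|=q_{i(n+1)}|\varDelta_{\alpha_1\dots\alpha_n}|$. Thus $|\varDelta_{\alpha_1\dots\alpha_n}|=\prod_{k=1}^n q_{\alpha_k k}$. For an infinite sequence $(\alpha_k)_{k\ge1}$ of digits in $\{0,\dots,s-1\}$, $\varDelta^{Q^*}_{\alpha_1\alpha_2\dots\alpha_k\dots}$ denotes the unique point of $\bigcap_{n\ge1}\varDelta_{\alpha_1\dots\alpha_n}$. Hausdorff dimension of a distribution: for a probability measure $\nu$ on the Borel subsets of $[0,1]$, $$\dim_H\nu=\inf\{\dim_H(E): E\subset[0,1]\text{ Borel},\ \nu(E)=1\},$$ where $\dim_H(E)$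 is the classical Hausdorff dimension of the set $E$ (the sets $E$ are not required to be closed). *)

(* Defs.v *)
From HB Require Import structures.
From mathcomp Require Import all_boot all_order all_algebra finmap.
From mathcomp Require Import all_classical all_reals all_analysis measurable_realfun.

Set Implicit Arguments.
Unset Strict Implicit.
Unset Printing Implicit Defensive.

Import Order.TTheory GRing.Theory Num.Theory.
Import numFieldNormedType.Exports.

Local Open Scope classical_set_scope.
Local Open Scope ring_scope.

(* Indices k in {1, 2, 3, ...} are shifted to nat: the column q_{. k} of a
   matrix, the k-th digit and the k-th random variable are stored at k.-1. *)

Section Hausdorff.
Context {R : realType}.
Local Open Scope ereal_scope.

(* equal to -oo on the empty set *)
Definition diameter (A : set R) : \bar R :=
  ereal_sup [set `|x.1 - x.2|%:E | x in A `*` A].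

(* |A|^a, with the conventions |set0|^a = 0 for all a >= 0, and |A|^0 = 1 for
   A != set0 *)
Definition diameter_pow (a : R) (A : set R) : \bar R :=
  if A == set0 then 0 else diameter A `^ a.

Definition hausdorff_premeasure (a e : R) (E : set R) : \bar R :=
  ereal_inf [set \sum_(i <oo) diameter_pow a (A i) | A in
    [set A : nat -> set R |
      (forall i, diameter (A i) <= e%:E) /\ E `<=` \bigcup_i A i]].

Definition hausdorff_measure (a : R) (E : set R) : \bar R :=
  ereal_sup [set hausdorff_premeasure a e E | e in [set e : R | (0 < e)%R]].

Definition hausdorff_dim (E : set R) : \bar R :=
  ereal_inf [set a%:E | a in
    [set a : R | (0 <= a)%R /\ hausdorff_measure a E = 0]].

Definition hausdorff_dim_distribution
    (nu : probability R R) : \bar R :=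
  ereal_inf [set hausdorff_dim E | E in
    [set E : set R |
      [/\ measurable E, E `<=` `[0%R, 1%R] & nu E = 1]]].

End Hausdorff.

(* Finite-valued random variables are functions that are measurable for the
   discrete sigma-algebra on the set D of values; D is not required to be a
   pointed type, hence is not a measurableType. *)
Section DiscreteRandomVariables.
Context d (T : measurableType d) (R : realType) (P : probability T R).
Context (D : finType).

Definition discrete_RV (X : T -> D) : Prop :=
  forall A : set D, measurable (X @^-1` A).

Definition independent_discrete_RVs (X : nat -> T -> D) : Prop :=
  forall (J : {fset nat}) (A : nat -> set D),
    P (\bigcap_(k in [set` J]) (X k @^-1` A k)) =
    (\prod_(k <- J) P (X k @^-1` A k))%E.

End DiscreteRandomVariables.

Section Qstar.
Context {R : realType} {s : nat}.
Implicit Types (q : 'I_s -> nat -> R) (a : nat -> 'I_s).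

Definition qmax q (k : nat) : R := \big[Num.max/0]_(i < s) q i k.

Definition is_Qstar_matrix q : Prop :=
  [/\ forall i k, 0 < q i k,
      forall k, \sum_(i < s) q i k = 1
    & (fun n => \prod_(k < n) qmax q k) @ \oo --> (0 : R)].

Definition cylinder_length q a (n : nat) : R := \prod_(k < n) q (a k) k.

Fixpoint cylinder_left q a (n : nat) : R :=
  if n is m.+1 then
    cylinder_left q a m +
      (\sum_(i < s | (i < a m)%N) q i m) * cylinder_length q a m
  else 0.

(* the cylinder of rank n determined by the first n digits of a *)
Definition cylinder q a (n : nat) : set R :=
  `[cylinder_left q a n, cylinder_left q a n + cylinder_length q a n].

Definition Qstar_point q a : R :=
  get (\bigcap_(n in [set n | (0 < n)%N]) cylinder q a n).

Lemma qmax_ub q i k : q i k <= qmax q k.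
Proof. by rewrite /qmax (bigmax_sup i). Qed.

Lemma cylinder_length_ge0 q a n :
  is_Qstar_matrix q -> 0 <= cylinder_length q a n.
Proof. by case=> q0 _ _; apply: prodr_ge0 => i _; apply/ltW/q0. Qed.

Lemma cylinder_lengthS q a n :
  cylinder_length q a n.+1 = cylinder_length q a n * q (a n) n.
Proof. by rewrite /cylinder_length big_ord_recr. Qed.

Lemma cvg_cylinder_length q a :
  is_Qstar_matrix q -> cylinder_length q a n @[n --> \oo] --> (0 : R).
Proof.
move=> hq; have [q0 _ h0] := hq.
apply: (@squeeze_cvgr _ _ _ _ (cst 0) (fun n => \prod_(k < n) qmax q k)).
- near=> n; rewrite cylinder_length_ge0//=.
  by apply: ler_prod => i _; rewrite ltW ?q0//= qmax_ub.
- exact: cvg_cst.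
- exact: h0.
Unshelve. all: by end_near. Qed.

Lemma cylinder_left_nd q a n : is_Qstar_matrix q ->
  cylinder_left q a n <= cylinder_left q a n.+1.
Proof.
move=> hq; have [q0 _ _] := hq; rewrite /= lerDl mulr_ge0//.
  by apply: sumr_ge0 => i _; apply/ltW/q0.
exact: cylinder_length_ge0.
Qed.

Lemma cylinder_right_ni q a n : is_Qstar_matrix q ->
  cylinder_left q a n.+1 + cylinder_length q a n.+1 <=
  cylinder_left q a n + cylinder_length q a n.
Proof.
move=> hq; have [q0 q1 _] := hq.
rewrite /= cylinder_lengthS -addrA lerD2l mulrC -mulrDr ler_piMr//.
  exact: cylinder_length_ge0.
rewrite -(q1 n) [leRHS](bigID (fun i : 'I_s => (i < a n)%N))/= lerD2l.
rewrite (bigD1 (a n)) ?ltnn//= lerDl.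
by apply: sumr_ge0 => i _; apply/ltW/q0.
Qed.

Lemma cylinder_nested q a m n : is_Qstar_matrix q -> (m <= n)%N ->
  cylinder q a n `<=` cylinder q a m.
Proof.
move=> hq /subnK <-; elim: (n - m)%N => // k ih x.
rewrite addSn => xk; apply: ih; move: xk; rewrite /cylinder /= !in_itv/=.
move=> /andP[lx xr]; apply/andP; split.
  exact: le_trans (cylinder_left_nd a (k + m) hq) lx.
exact: le_trans xr (cylinder_right_ni a (k + m) hq).
Qed.

Lemma bigcap_cylinder_neq0 q a : is_Qstar_matrix q ->
  exists x, forall n, cylinder q a n x.
Proof.
move=> hq.
have lin m n : (m <= n)%N -> cylinder q a m (cylinder_left q a n).
  move=> mn; apply: (cylinder_nested hq mn).
  by rewrite /cylinder /= in_itv/= lexx lerDl cylinder_length_ge0.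
have nd : nondecreasing_seq (cylinder_left q a).
  by apply/nondecreasing_seqP => n; exact: cylinder_left_nd.
have cv : cvgn (cylinder_left q a).
  apply: nondecreasing_is_cvgn => //.
  exists (cylinder_left q a 0 + cylinder_length q a 0) => _ [n _ <-].
  by have := lin 0%N n isT; rewrite /cylinder /= in_itv/= => /andP[].
exists (limn (cylinder_left q a)) => n.
rewrite /cylinder /= in_itv/= nondecreasing_cvgn_le//=.
apply: limr_le => //; near=> m.
have nm : (n <= m)%N by near: m; exists n.
by have := lin _ _ nm; rewrite /cylinder /= in_itv/= => /andP[].
Unshelve. all: by end_near. Qed.

Lemma Qstar_pointP q a n : is_Qstar_matrix q -> cylinder q a n (Qstar_point q a).
Proof.
move=> hq; have [x hx] := bigcap_cylinder_neq0 a hq.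
have h : (\bigcap_(n in [set n | (0 < n)%N]) cylinder q a n) (Qstar_point q a).
  by apply: (@getPex _ (fun y => (\bigcap_(n in _) cylinder q a n) y)); exists x.
case: n => [|n]; last exact: h.
by apply: (cylinder_nested hq (leqnSn 0)); exact: h.
Qed.

Lemma cvg_cylinder_left q a : is_Qstar_matrix q ->
  cylinder_left q a n @[n --> \oo] --> Qstar_point q a.
Proof.
move=> hq.
apply: (@squeeze_cvgr _ _ _ _
  (fun n => Qstar_point q a - cylinder_length q a n) (cst (Qstar_point q a))).
- near=> n; have := Qstar_pointP a n hq.
  by rewrite /cylinder /= in_itv/= lerBlDr => /andP[-> ->].
- rewrite -[X in _ --> X]subr0; apply: cvgB; first exact: cvg_cst.
  exact: (cvg_cylinder_length a hq).
- exact: cvg_cst.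
Unshelve. all: by end_near. Qed.

Lemma Qstar_point_unique q a x : is_Qstar_matrix q ->
  (forall n, (0 < n)%N -> cylinder q a n x) -> x = Qstar_point q a.
Proof.
move=> hq hx.
have hlx : cylinder_left q a n @[n --> \oo] --> x; last first.
  rewrite -(cvg_lim (@Rhausdorff R) hlx).
  exact: (cvg_lim (@Rhausdorff R) (cvg_cylinder_left hq)).
apply: (@squeeze_cvgr _ _ _ _
  (fun n => x - cylinder_length q a n) (cst x)).
- near=> n; have n0 : (0 < n)%N by near: n; exists 1%N.
  by have := hx _ n0; rewrite /cylinder /= in_itv/= lerBlDr => /andP[-> ->].
- rewrite -[X in _ --> X]subr0; apply: cvgB; first exact: cvg_cst.
  exact: (cvg_cylinder_length a hq).
- exact: cvg_cst.
Unshelve. all: by end_near. Qed.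

Context d (T : measurableType d) (P : probability T R).

Lemma measurable_Qstar_point q (X : nat -> T -> 'I_s) :
  is_Qstar_matrix q -> (forall k, discrete_RV (X k)) ->
  measurable_fun [set: T] (fun t => Qstar_point q (fun k => X k t)).
Proof.
move=> hq hX; apply: (@measurable_fun_cvg _ _ _ _
  (fun n t => cylinder_left q (fun k => X k t) n)); last first.
  by move=> t _; exact: cvg_cylinder_left.
have mF (F : 'I_s -> R) k : measurable_fun [set: T] (fun t => F (X k t)).
  by move=> _ B _; rewrite setTI; exact: (hX k (F @^-1` B)).
have mL n : measurable_fun [set: T]
    (fun t => cylinder_length q (fun k => X k t) n).
  elim: n => [|n ih].
    rewrite (_ : (fun _ => _) = cst 1)//.
    by apply/funext => t; rewrite /cylinder_length big_ord0.
  rewrite (_ : (fun t => _) = (fun t =>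
    cylinder_length q (fun k => X k t) n * q (X n t) n)); last first.
    by apply/funext => t; rewrite cylinder_lengthS.
  by apply: measurable_funM => //; exact: (mF (fun i => q i n)).
elim=> //= n ih; apply: measurable_funD => //; apply: measurable_funM => //.
exact: (mF (fun j => \sum_(i < s | (i < j)%N) q i n)).
Qed.

Definition Qstar_RV q (hq : is_Qstar_matrix q) (X : nat -> T -> 'I_s)
    (hX : forall k, discrete_RV (X k)) : {RV P >-> R} :=
  mfun_Sub (mem_set (measurable_Qstar_point hq hX)).

End Qstar.

Section Quantities.
Context {R : realType} {s : nat}.
Implicit Types p q : 'I_s -> nat -> R.

Definition entropy p (j : nat) : R := - \sum_(i < s) p i j * ln (p i j).

Definition sum_entropy p (n : nat) : R := \sum_(j < n) entropy p j.

Definition cross_entropy p q (j : nat) : R := - \sum_(i < s) p i j * ln (q i j).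

Definition sum_cross_entropy p q (n : nat) : R :=
  \sum_(j < n) cross_entropy p q j.

Definition log_variance p q (j : nat) : R :=
  - cross_entropy p q j ^+ 2 + \sum_(i < s) p i j * ln (q i j) ^+ 2.

Definition fineness q (delta : R) : \bar R :=
  ereal_sup [set (\sum_(k <oo)
    ((\prod_(i < k.+1) qmax q (m + i)%N) `^ delta)%:E)%E | m in [set: nat]].

End Quantities.

(* Main.v *)
Require Import Defs.
From HB Require Import structures.
From mathcomp Require Import all_boot all_order all_algebra finmap.
From mathcomp Require Import all_classical all_reals all_analysis measurable_realfun.
From mathcomp Require Import ring lra.

Set Implicit Arguments.
Unset Strict Implicit.
Unset Printing Implicit Defensive.

Import Order.TTheory GRing.Theory Num.Theory.
Import numFieldNormedType.Exports.

Local Open Scope classical_set_scope.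
Local Open Scope ring_scope.

(** Let [L_n] be the length of the cylinder of rank [n] given by the random
    digits, and [P_n] its mass, the product of the probabilities of the digits.
    Then [- ln P_n] and [- ln L_n] are sums of independent variables with
    expectations [H_n] and [B_n]. Both satisfy the strong law of large numbers:
    the variances of the terms of the second are the [d_j], and those of the
    first are bounded because [x * ln x ^ 2 <= 4] on [[0, 1]]. As [B_n] grows at
    least linearly, the errors [o(n)] are [o(B_n)], and with
    [D := liminf H_n / B_n] one gets almost surely that [P_n <= L_n `^ r] for
    all large [n] if [r < D], and that [L_n `^ r <= P_n] for infinitely many [n]
    if [D < r] ([ae_mass_le], [ae_mass_ge]).

    The strong law itself comes from Ville's maximal inequality for nonnegative
    supermartingales on the tree of words ([ville_inequality]), applied to
    [(S_n / n) ^ 2 + \sum_(k >= n) Var X_k / (k + 1) ^ 2] ([hajek_renyi],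
    [strong_law]).

    Upper bound. For [D < r < a], the points lying in infinitely many cylinders
    with [L_n `^ r <= P_n] form a Borel set of full measure. These cylinders
    cover it, and those of rank [n] contribute at most [M_n `^ (a - r)] to the
    [a]-dimensional sum, where [M_n] is the product of the first [n] column
    maxima, since the masses of one rank add up to [1]. Finiteness of
    [S(a - r)] makes the tails of this series small
    ([hausdorff_measure_heavy_points]).

    Lower bound. For [alpha < r < D] there is an event [G] of positive
    probability on which [P_n <= C * L_n `^ r] for all [n]. The main point is
    that arbitrary small sets, and not only cylinders, have small mass in [G]:
    an interval of length [x] meets at most two cylinders longer than [x] of
    each rank, which leads to the bound
    [K * x `^ alpha * \sum_n M_n `^ (r - alpha)] ([interval_mass_le]), and the
    last series converges by finiteness of [S(r - alpha)]. A cover of a set of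
    full measure therefore has an [alpha]-dimensional sum bounded away from [0]
    ([hausdorff_measure_neq0]). *)

(** * Words and random digits *)

Section Words.
Context {R : realType} {s : nat}.
Implicit Types (q : 'I_s -> nat -> R) (a b : nat -> 'I_s).

Lemma eq_cylinder_length q a b n :
  (forall k, (k < n)%N -> a k = b k) ->
  cylinder_length q a n = cylinder_length q b n.
Proof. by move=> ab; apply: eq_bigr => k _; rewrite ab. Qed.

Lemma eq_cylinder_left q a b n :
  (forall k, (k < n)%N -> a k = b k) ->
  cylinder_left q a n = cylinder_left q b n.
Proof.
elim: n => //= n ih ab; rewrite ab// ih; last by move=> k kn; rewrite ab// ltnW.
by rewrite (@eq_cylinder_length q a b)// => k kn; rewrite ab// ltnW.
Qed.

Lemma eq_cylinder q a b n :
  (forall k, (k < n)%N -> a k = b k) -> cylinder q a n = cylinder q b n.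
Proof.
by move=> ab; rewrite /cylinder (eq_cylinder_left q ab)
  (eq_cylinder_length q ab).
Qed.

(** Words are finite sequences of digits; [nth i0 w] turns a word into an
    infinite sequence, of which only the first [size w] digits matter. *)
Lemma cylinder_length_rcons q (i0 : 'I_s) (w : seq 'I_s) i :
  cylinder_length q (nth i0 (rcons w i)) (size w).+1 =
  cylinder_length q (nth i0 w) (size w) * q i (size w).
Proof.
rewrite cylinder_lengthS nth_rcons ltnn eqxx; congr (_ * _).
by apply: eq_cylinder_length => k kw; rewrite nth_rcons kw.
Qed.

(** Expanding the product of the column sums gives the sum over all words. *)
Lemma sum_cylinder_length (p : 'I_s -> nat -> R) (i0 : 'I_s) n :
  (forall k, \sum_(i < s) p i k = 1) ->
  \sum_(w : n.-tuple 'I_s) cylinder_length p (nth i0 w) n = 1.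
Proof.
move=> p1; transitivity (\prod_(k < n) \sum_(i < s) p i k); last first.
  by rewrite big1.
rewrite bigA_distr_bigA/=.
rewrite (reindex (fun f : {ffun 'I_n -> 'I_s} => [tuple f k | k < n]))/=.
  apply: eq_bigr => f _; apply: eq_bigr => k _; congr (p _ _).
  by rewrite (nth_map k) ?size_enum_ord// nth_ord_enum.
exists (fun w : n.-tuple 'I_s => [ffun k => tnth w k]) => [f|w] _.
  by apply/ffunP => k; rewrite ffunE tnth_mktuple.
by apply: eq_from_tnth => k; rewrite tnth_mktuple ffunE.
Qed.

End Words.

Section Digits.
Context {R : realType} {s : nat} (p : 'I_s -> nat -> R).
Context {d : measure_display} {T : measurableType d} (P : probability T R).
Context (xi : nat -> T -> 'I_s).

Definition digits (n : nat) (t : T) : seq 'I_s := mkseq (xi ^~ t) n.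

Lemma size_digits n t : size (digits n t) = n.
Proof. exact: size_mkseq. Qed.

Lemma digitsS n t : digits n.+1 t = rcons (digits n t) (xi n t).
Proof. exact: mkseqS. Qed.

Lemma nth_digits i0 n t k : (k < n)%N -> nth i0 (digits n t) k = xi k t.
Proof. by move=> kn; rewrite nth_mkseq. Qed.

Definition word_event (w : seq 'I_s) : set T :=
  [set t | digits (size w) t = w].

Lemma word_eventE i0 w : word_event w =
  \bigcap_(k in [set` [fset k in iota 0 (size w)]%fset])
    (xi k @^-1` [set nth i0 w k]).
Proof.
apply/seteqP; split => t /=.
  move=> tw k /=; rewrite !inE mem_iota/= add0n => kw.
  by rewrite -tw nth_digits.
move=> h; apply: (@eq_from_nth _ i0); first by rewrite size_digits.
move=> k; rewrite size_digits => kw; rewrite nth_digits//.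
by apply: h; rewrite /= !inE mem_iota.
Qed.

Hypothesis hxi : forall k, discrete_RV (xi k).

Lemma measurable_word_event w : measurable (word_event w).
Proof.
case: w => [|i0 w].
  by rewrite (_ : word_event _ = setT)//; apply/seteqP; split.
rewrite (word_eventE i0); apply: fin_bigcap_measurable; first exact: finite_fset.
by move=> k _; exact: hxi.
Qed.

(** There are countably many words, so that whatever depends only on finitely
    many digits is measurable. *)
Lemma measurable_digits (Q : seq 'I_s -> Prop) n :
  measurable [set t | Q (digits n t)].
Proof.
rewrite (_ : [set t | _] =
  \bigcup_(w : seq 'I_s) (if `[< size w = n /\ Q w >] then word_event w
    else set0)); last first.
  apply/seteqP; split => t /=.
    move=> Qt; exists (digits n t) => //.
    by case: asboolP => [_|[]]; rewrite ?size_digits// /word_event/= size_digits.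
  by move=> [w _]; case: asboolP => // -[<- Qw] /= ->.
apply: countable_bigcupT_measurable => // w.
by case: asboolP => // _; exact: measurable_word_event.
Qed.

Hypothesis hxi_indep : independent_discrete_RVs P xi.
Hypothesis hxi_dist : forall k i, P (xi k @^-1` [set i]) = (p i k)%:E.

Lemma probability_word_event i0 (w : seq 'I_s) :
  P (word_event w) = (cylinder_length p (nth i0 w) (size w))%:E.
Proof.
rewrite (word_eventE i0) hxi_indep (perm_big (iota 0 (size w)))/=; last first.
  by apply: uniq_perm; rewrite ?fset_uniq ?iota_uniq// => k; rewrite !inE.
under eq_bigr do rewrite hxi_dist.
rewrite prodEFin /cylinder_length -(big_mkord predT (fun k => p (nth i0 w k) k)).
by rewrite /index_iota subn0.
Qed.

(** A union bound over finitely many words turns the estimate of a probability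
    into that of a finite sum of products. *)
Lemma probability_le_sum_words i0 (I : finType) (S : pred I)
    (w : I -> seq 'I_s) (A : set T) : measurable A ->
  (forall t, A t -> exists2 x, S x & word_event (w x) t) ->
  (P A <= (\sum_(x | S x) cylinder_length p (nth i0 (w x)) (size (w x)))%:E)%E.
Proof.
move=> mA AS; rewrite -sumEFin.
under eq_bigr do rewrite -probability_word_event.
apply: (@le_trans _ _ (\sum_(x \in [set` S]) P (word_event (w x)))%E).
  by apply: content_sub_fsum => // x _; exact: measurable_word_event.
by rewrite -(bigfs _ (index_enum_uniq I)) ?lexx// => x _; rewrite mem_index_enum.
Qed.

End Digits.

(** * Ville's maximal inequality *)

Section Ville.
Context {R : realType} {s : nat} (p : 'I_s -> nat -> R).
Context {d : measure_display} {T : measurableType d} (P : probability T R).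
Context (xi : nat -> T -> 'I_s).
Hypothesis hp0 : forall i k, 0 <= p i k.
Hypothesis hxi : forall k, discrete_RV (xi k).
Hypothesis hxi_indep : independent_discrete_RVs P xi.
Hypothesis hxi_dist : forall k i, P (xi k @^-1` [set i]) = (p i k)%:E.
Variables (i0 : 'I_s) (V : seq 'I_s -> R) (l : R).
Hypothesis V_ge0 : forall w, 0 <= V w.
Hypothesis V_super : forall w,
  \sum_(i < s) p i (size w) * V (rcons w i) <= V w.
Hypothesis l_gt0 : 0 < l.

Let hit (w : seq 'I_s) (n : nat) : set T :=
  word_event xi w `&` \bigcup_(k in [set k | (size w <= k <= size w + n)%N])
    [set t | l <= V (digits xi k t)].

Let measurable_hit w n : measurable (hit w n).
Proof.
apply: measurableI; first exact: measurable_word_event.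
apply: bigcup_measurable => k _.
exact: (measurable_digits hxi (fun u => l <= V u)).
Qed.

(** The induction on the horizon has to let the starting word vary: either the
    threshold is already reached at this word, or one more digit is read and
    the supermartingale inequality adds up the bounds for the continuations. *)
Let hit_le w n : (P (hit w n) <=
  (cylinder_length p (nth i0 w) (size w) * (V w / l))%:E)%E.
Proof.
have len_ge0 u : 0 <= cylinder_length p (nth i0 u) (size u).
  by apply: prodr_ge0 => k _.
have reached u m : l <= V u -> (P (hit u m) <=
    (cylinder_length p (nth i0 u) (size u) * (V u / l))%:E)%E.
  move=> lV; apply: (@le_trans _ _ (P (word_event xi u))).
    apply: le_measure; rewrite ?inE; [exact: measurable_hit| |exact: subIsetl].
    exact: measurable_word_event.
  rewrite (probability_word_event hxi_indep hxi_dist i0) lee_fin.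
  by rewrite ler_peMr// ler_pdivlMr// mul1r.
elim: n w => [|n ih] w; have [/reached//|Vl] := leP l (V w).
  rewrite (_ : hit w 0 = set0).
    by rewrite measure0 lee_fin mulr_ge0// divr_ge0// ltW.
  apply/seteqP; split => // t [/= wt [k /=]]; rewrite addn0 -eqn_leq => /eqP <-.
  by rewrite wt leNgt Vl.
apply: (@le_trans _ _
    (\sum_(i \in [set` predT : {pred 'I_s}]) P (hit (rcons w i) n))%E).
  apply: content_sub_fsum => // t [/= wt [k /= /andP[wk kn] lV]].
  exists (xi (size w) t) => //=; split.
    by rewrite /word_event/= size_rcons digitsS wt.
  exists k => //=; rewrite size_rcons addSnnS kn andbT ltn_neqAle wk andbT.
  by apply: contraTneq lV => <-; rewrite wt -ltNge.
rewrite -(bigfs _ (index_enum_uniq 'I_s))//; last first.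
  by move=> i _; rewrite mem_index_enum.
apply: (@le_trans _ _ (\sum_(i < s)
    ((cylinder_length p (nth i0 w) (size w) / l) *
      (p i (size w) * V (rcons w i)))%:E)%E).
  apply: lee_sum => i _; apply: (le_trans (ih _)).
  by rewrite size_rcons cylinder_length_rcons lee_fin le_eqVlt; apply/orP; left;
    apply/eqP; ring.
rewrite sumEFin lee_fin -mulr_sumr -mulrA ler_wpM2l// mulrC ler_wpM2r//.
by rewrite invr_ge0 ltW.
Qed.

(** For a nonnegative supermartingale on the tree of words, Ville's maximal
    inequality follows from the bounds with finite horizon by continuity of the
    measure. *)
Lemma ville_inequality :
  (P [set t | exists n, (l <= V (digits xi n t))%R] <= (V [::] / l)%:E)%E.
Proof.
rewrite (_ : [set t | _] = \bigcup_n hit [::] n); last first.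
  apply/seteqP; split => t /=.
    by move=> [n lV]; exists n => //; split => //; exists n => //=.
  by move=> [n _ [_ [k _ lV]]]; exists k.
have : P \o hit [::] @ \oo --> P (\bigcup_n hit [::] n).
  apply: nondecreasing_cvg_mu => //; first exact: bigcup_measurable.
  apply/nondecreasing_seqP => n; rewrite subsetEset => t [wt [k /= kn lV]].
  by split => //; exists k => //=; rewrite (leq_trans kn).
move=> cv; rewrite -(cvg_lim _ cv)//; apply: lime_le.
  by apply/cvg_ex; eexists; exact: cv.
apply: nearW => n /=; apply: le_trans (hit_le _ _) _.
by rewrite /cylinder_length big_ord0 mul1r.
Qed.

End Ville.

(** * The strong law of large numbers *)

Section LargeNumbers.
Context {R : realType} {s : nat} (p : 'I_s -> nat -> R).
Context {d : measure_display} {T : measurableType d} (P : probability T R).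
Context (xi : nat -> T -> 'I_s).
Hypothesis hp0 : forall i k, 0 <= p i k.
Hypothesis hp1 : forall k, \sum_(i < s) p i k = 1.
Hypothesis hxi : forall k, discrete_RV (xi k).
Hypothesis hxi_indep : independent_discrete_RVs P xi.
Hypothesis hxi_dist : forall k i, P (xi k @^-1` [set i]) = (p i k)%:E.

Implicit Types f : 'I_s -> nat -> R.

(** For independent centred [X_k] with sums [S_n], the process
    [(S_n / n) ^ 2 + \sum_(k >= n) Var X_k / (k + 1) ^ 2] is a nonnegative
    supermartingale: passing from [n] to [n + 1] adds at most
    [Var X_n / (n + 1) ^ 2] to the expected square, which is what the second
    term loses. Ville's inequality then controls all averages at once. *)
Lemma hajek_renyi (i0 : 'I_s) f (B e : R) :
  (forall k, \sum_(i < s) p i k * f i k = 0) ->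
  (forall n, \sum_(k < n) (\sum_(i < s) p i k * f i k ^+ 2) / k.+1%:R ^+ 2 <= B) ->
  0 < e ->
  (P [set t | exists2 n, (0 < n)%N &
       (e * n%:R <= `|\sum_(k < n) f (xi k t) k|)%R] <= (B / e ^+ 2)%:E)%E.
Proof.
move=> f0 fB e0.
pose v k := (\sum_(i < s) p i k * f i k ^+ 2) / k.+1%:R ^+ 2.
pose S (w : seq 'I_s) := \sum_(k < size w) f (nth i0 w k) k.
pose V (w : seq 'I_s) :=
  (S w / (size w)%:R) ^+ 2 + (B - \sum_(k < size w) v k).
have V_ge0 w : 0 <= V w by rewrite addr_ge0 ?sqr_ge0// subr_ge0 fB.
have S_rcons w i : S (rcons w i) = S w + f i (size w).
  rewrite /S size_rcons big_ord_recr/= nth_rcons ltnn eqxx; congr (_ + _).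
  by apply: eq_bigr => k _; rewrite nth_rcons ltn_ord.
have V_super w : \sum_(i < s) p i (size w) * V (rcons w i) <= V w.
  set n := size w; set c : R := n.+1%:R ^- 2.
  rewrite (eq_bigr (fun i => p i n * (c * S w ^+ 2 + B - \sum_(k < n.+1) v k) +
      (p i n * f i n) * (2 * c * S w) + (p i n * f i n ^+ 2) * c)); last first.
    move=> i _; rewrite /V S_rcons size_rcons expr_div_n -/n -/c.
    by move: (\sum_(k < _) v k) => u; ring.
  rewrite !big_split/= -!mulr_suml hp1 f0 mul0r addr0 mul1r.
  have cS : c * S w ^+ 2 <= (S w / n%:R) ^+ 2.
    rewrite expr_div_n mulrC; have [n0|n0] := posnP n.
      by rewrite /S -/n n0 big_ord0 expr0n !mul0r.
    rewrite ler_wpM2l ?sqr_ge0// lef_pV2 ?posrE ?exprn_gt0 ?ltr0n//.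
    by rewrite ler_sqr ?nnegrE// ler_nat.
  rewrite big_ord_recr/= {2}/v -/c /V -/n.
  by move: cS; set sg := \sum_(i < s) _; set u := \sum_(k < n) _; lra.
have S0 t n : \sum_(k < n) f (xi k t) k = S (digits xi n t).
  by rewrite /S size_digits; apply: eq_bigr => k _; rewrite nth_digits.
apply: (@le_trans _ _ (P [set t | exists n, (e ^+ 2 <= V (digits xi n t))%R])).
  apply: le_measure; rewrite ?inE.
  - rewrite (_ : [set t | _] = \bigcup_(n in [set n | (0 < n)%N])
      [set t | (e * n%:R <= `|\sum_(k < n) f (xi k t) k|)%R]); last first.
      by apply/seteqP; split => t [n] ? ?; exists n.
    apply: bigcup_measurable => n _.
    rewrite (_ : [set t | _] = [set t | e * n%:R <= `|S (digits xi n t)|]).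
      exact: (measurable_digits hxi (fun w => e * n%:R <= `|S w|)).
    by apply/seteqP; split => t /=; rewrite S0.
  - rewrite (_ : [set t | _] = \bigcup_n [set t | e ^+ 2 <= V (digits xi n t)]).
      apply: bigcup_measurable => n _.
      exact: (measurable_digits hxi (fun w => e ^+ 2 <= V w)).
    by apply/seteqP; split => t [n] => [h|_ h]; exists n.
  - move=> t [n n0 /=]; rewrite S0 => h; exists n.
    rewrite /V size_digits -[leLHS]addr0 lerD//; last first.
      by rewrite subr_ge0 fB.
    rewrite -[leRHS]real_normK ?num_real// ler_sqr ?nnegrE ?(ltW e0)//.
    by rewrite normrM normfV normr_nat ler_pdivlMr// ltr0n.
apply: le_trans (ville_inequality hp0 hxi hxi_indep hxi_dist i0 V_ge0 V_super _) _.
  by rewrite exprn_gt0.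
by rewrite /V /S/= !big_ord0 mul0r expr0n add0r subr0.
Qed.

(** The strong law follows by applying the inequality to the variables whose
    first [M] terms are replaced by [0]: this leaves only a tail of the
    convergent series as a bound, and changes each sum by an amount which is
    negligible compared with [n]. *)
Lemma strong_law (i0 : 'I_s) f (B e : R) :
  (forall k, \sum_(i < s) p i k * f i k = 0) ->
  (forall n, \sum_(k < n) (\sum_(i < s) p i k * f i k ^+ 2) / k.+1%:R ^+ 2 <= B) ->
  0 < e ->
  {ae P, forall t, \forall n \near \oo,
    `|\sum_(k < n) f (xi k t) k| < e * n%:R}.
Proof.
move=> f0 fB e0; pose S t n := \sum_(k < n) f (xi k t) k.
pose v k := (\sum_(i < s) p i k * f i k ^+ 2) / k.+1%:R ^+ 2.
have v_ge0 k : 0 <= v k.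
  by rewrite divr_ge0// sumr_ge0// => i _; rewrite mulr_ge0// sqr_ge0.
pose bad := [set t | forall N, exists2 n, (N <= n)%N & e * n%:R <= `|S t n|].
have mbad : measurable bad.
  rewrite (_ : bad = \bigcap_N \bigcup_(n in [set n | (N <= n)%N])
      [set t | e * n%:R <= `|S t n|]); last first.
    apply/seteqP; split => t /=.
      by move=> h N _; have [n Nn hn] := h N; exists n.
    by move=> h N; have [n /= Nn hn] := h N Logic.I; exists n.
  apply: bigcap_measurable => // N _; apply: bigcup_measurable => n _.
  rewrite (_ : [set t | _] = [set t | e * n%:R <=
      `|\sum_(k < n) f (nth i0 (digits xi n t) k) k|]).
    exact: (measurable_digits hxi
      (fun w => e * n%:R <= `|\sum_(k < n) f (nth i0 w k) k|)).
  have SE t : S t n = \sum_(k < n) f (nth i0 (digits xi n t) k) k.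
    by apply: eq_bigr => k _; rewrite nth_digits.
  by apply/seteqP; split => t /=; rewrite SE.
exists bad; split => //; last first.
  move=> t /= tgood; apply: contrapT => tbad; apply: tgood.
  move/existsNP : tbad => [N hN]; exists N => // n /= Nn.
  by rewrite ltNge; apply/negP => h; apply: hN; exists n.
have bad_tail M b : (forall n, \sum_(M <= k < n) v k <= b) ->
    (P bad <= (b / (e / 2) ^+ 2)%:E)%E.
  move=> vb; pose g i k := if (k < M)%N then 0 else f i k.
  have g0 k : \sum_(i < s) p i k * g i k = 0.
    rewrite /g; case: (ltnP k M) => _ //.
    by rewrite big1// => i _; rewrite mulr0.
  have gB n : \sum_(k < n) (\sum_(i < s) p i k * g i k ^+ 2) / k.+1%:R ^+ 2 <= b.
    apply: le_trans (vb n); rewrite (@big_nat_widenl _ _ _ M 0%N)// big_mkord.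
    rewrite [leRHS]big_mkcond/=.
    apply: ler_sum => k _; rewrite /g; case: (ltnP k M) => // kM.
    by rewrite big1 ?mul0r// => i _; rewrite expr0n mulr0.
  have e20 : 0 < e / 2 by rewrite divr_gt0.
  apply: le_trans (hajek_renyi i0 g0 gB e20); apply: le_measure; rewrite ?inE//.
    rewrite (_ : [set t | _] = \bigcup_(n in [set n | (0 < n)%N])
      [set t | e / 2 * n%:R <= `|\sum_(k < n) g (nth i0 (digits xi n t) k) k|]).
      apply: bigcup_measurable => n _.
      exact: (measurable_digits hxi
        (fun w => e / 2 * n%:R <= `|\sum_(k < n) g (nth i0 w k) k|)).
    have E t n : \sum_(k < n) g (nth i0 (digits xi n t) k) k =
        \sum_(k < n) g (xi k t) k.
      by apply: eq_bigr => k _; rewrite nth_digits.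
    by apply/seteqP; split => t /= [n n0 h]; exists n => //; move: h; rewrite /= E.
  move=> t tbad /=.
  pose N := (Num.truncn (`|S t M| / (e / 2))).+1.
  have [n nN hn] := tbad (maxn (maxn N M) 1).
  move: nN; rewrite !geq_max => /andP[/andP[Nn Mn] n0]; exists n => //.
  have SM : `|S t M| <= e / 2 * n%:R.
    rewrite mulrC -ler_pdivrMr//; apply: le_trans (ltW (truncnS_gt _)) _.
    by rewrite ler_nat.
  have <- : S t n - S t M = \sum_(k < n) g (xi k t) k.
    have -> : S t n = S t M + \sum_(M <= k < n) f (xi k t) k.
      by rewrite /S -!(big_mkord predT (fun k => f (xi k t) k)) -big_cat_nat.
    rewrite [_ - _]addrC addKr (@big_nat_widenl _ _ _ M 0%N)// big_mkord.
    rewrite big_mkcond/=.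
    by apply: eq_bigr => k _; rewrite /g; case: (ltnP k M).
  have := ler_normB (S t n) (S t M); have := lerB_dist (S t n) (S t M).
  by lra.
apply/eqP; rewrite eq_le measure_ge0 andbT; apply/lee_addgt0Pr => r r0.
rewrite add0e; pose r' := r * (e / 2) ^+ 2.
have r'0 : 0 < r' by rewrite mulr_gt0// exprn_gt0// divr_gt0.
have cv : cvgn (fun n => \sum_(0 <= k < n) v k).
  apply: nondecreasing_is_cvgn.
    by apply/nondecreasing_seqP => n; rewrite big_nat_recr//= lerDl.
  by exists B => _ [n _ <-]; rewrite big_mkord fB.
have /cvgrPdist_lt/(_ _ r'0)[M _ hM] := cv.
have le_lim n : \sum_(0 <= k < n) v k <= limn (fun n => \sum_(0 <= k < n) v k).
  apply: nondecreasing_cvgn_le => //.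
  by apply/nondecreasing_seqP => m; rewrite big_nat_recr//= lerDl.
apply: le_trans (bad_tail M r' _) _; last first.
  by rewrite lee_fin /r' mulfK// gt_eqF// exprn_gt0// divr_gt0.
move=> n; have [nM|Mn] := leqP n M.
  by rewrite big_geq// ltW.
have := le_lim n; have := hM M (leqnn M); rewrite /= ger0_norm ?subr_ge0//.
rewrite [X in X <= _ -> _](big_cat_nat _ (ltnW Mn))//=.
by lra.
Qed.

End LargeNumbers.

(** * Logarithms of probabilities *)

Section Entropy.
Context {R : realType} {s : nat} (p : 'I_s -> nat -> R).
Hypothesis hp0 : forall i k, 0 <= p i k.
Hypothesis hp1 : forall k, \sum_(i < s) p i k = 1.

Lemma le1_prob i k : p i k <= 1.
Proof.
by rewrite -(hp1 k) (bigD1 i)//= lerDl sumr_ge0.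
Qed.

(** Near [0], write [- ln x = 2 * ln y] with [y = 1 / sqrt x] and use
    [ln y <= y]. *)
Lemma mul_ln_sqr_le4 (x : R) : 0 <= x <= 1 -> x * ln x ^+ 2 <= 4.
Proof.
move=> /andP[x0 x1]; have [->|xn0] := eqVneq x 0; first by rewrite mul0r.
have xgt0 : 0 < x by rewrite lt_neqAle eq_sym xn0.
have y0 : 0 < Num.sqrt x by rewrite sqrtr_gt0.
have yE : Num.sqrt x ^+ 2 = x by rewrite sqr_sqrtr.
have lnE : ln x = - (2 * ln (Num.sqrt x)^-1).
  by rewrite -{1}yE lnXn// lnV ?posrE// mulrN opprK mulr_natl.
have h0 : 0 <= ln (Num.sqrt x)^-1.
  by rewrite ln_ge0// invf_ge1// -sqrtr1 ler_wsqrtr.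
have h1 : ln (Num.sqrt x)^-1 <= (Num.sqrt x)^-1.
  by rewrite ltW// ln_sublinear// invr_gt0.
rewrite lnE sqrrN exprMn mulrCA -{1}yE -exprMn.
rewrite -[leRHS](mulr1 4) ler_pM ?sqr_ge0//; first by rewrite -natrX.
have ge0 : 0 <= Num.sqrt x * ln (Num.sqrt x)^-1 by rewrite mulr_ge0// ltW.
rewrite -(expr1n _ 2) ler_sqr ?nnegrE//.
by rewrite -ler_pdivlMl// mulr1.
Qed.

(** Telescoping, by [(x + 1) ^- 2 <= x^-1 - (x + 1)^-1]. *)
Lemma sum_inv_sqr_le2 n : \sum_(k < n) (k.+1%:R ^- 2 : R) <= 2.
Proof.
case: n => [|n]; first by rewrite big_ord0.
suff : \sum_(k < n.+1) (k.+1%:R ^- 2 : R) <= 2 - n.+1%:R^-1.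
  by move/le_trans; apply; rewrite gerBl.
elim: n => [|n ih].
  by rewrite big_ord1 expr1n !invr1 -[2]/(1 + 1) addrK.
rewrite big_ord_recr/=; apply: (le_trans (lerD ih (lexx _))).
have x0 : (0 : R) < n.+1%:R by rewrite ltr0n.
have -> : n.+2%:R = n.+1%:R + 1 :> R by rewrite -natr1.
move: x0; set x : R := n.+1%:R => x0.
have x10 : 0 < x + 1 by rewrite addr_gt0.
have -> : x^-1 = (x + 1)^-1 + (x * (x + 1))^-1 by field; rewrite !gt_eqF.
suff : (x + 1) ^- 2 <= (x * (x + 1))^-1.
  move: ((x + 1) ^- 2) ((x * (x + 1))^-1) ((x + 1)^-1) => a b c ab.
  by clear -ab; lra.
rewrite lef_pV2 ?posrE ?mulr_gt0 ?exprn_gt0// expr2 ler_pM2r//.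
by rewrite lerDl.
Qed.

Variables (d : measure_display) (T : measurableType d) (P : probability T R).
Variables (xi : nat -> T -> 'I_s).
Hypothesis hxi : forall k, discrete_RV (xi k).
Hypothesis hxi_indep : independent_discrete_RVs P xi.
Hypothesis hxi_dist : forall k i, P (xi k @^-1` [set i]) = (p i k)%:E.

Lemma sum_sqr_centred (u : 'I_s -> nat -> R) k :
  \sum_(i < s) p i k * (u i k - \sum_(j < s) p j k * u j k) ^+ 2 =
  \sum_(i < s) p i k * u i k ^+ 2 - (\sum_(j < s) p j k * u j k) ^+ 2.
Proof.
set m := \sum_(j < s) p j k * u j k.
rewrite (eq_bigr (fun i => p i k * u i k ^+ 2 + p i k * u i k * (- 2 * m) +
  p i k * m ^+ 2)); last by move=> i _; ring.
by rewrite !big_split/= -!mulr_suml hp1 -/m; ring.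
Qed.

Lemma strong_law_uncentred (i0 : 'I_s) (u : 'I_s -> nat -> R) (B e : R) :
  (forall n, \sum_(k < n) (\sum_(i < s) p i k * u i k ^+ 2 -
     (\sum_(i < s) p i k * u i k) ^+ 2) / k.+1%:R ^+ 2 <= B) ->
  0 < e ->
  {ae P, forall t, \forall n \near \oo,
    `|\sum_(k < n) u (xi k t) k - \sum_(k < n) \sum_(i < s) p i k * u i k| <
      e * n%:R}.
Proof.
move=> uB e0.
pose f i k := u i k - \sum_(j < s) p j k * u j k.
have f0 k : \sum_(i < s) p i k * f i k = 0.
  rewrite /f; under eq_bigr do rewrite mulrBr.
  by rewrite big_split/= sumrN -mulr_suml hp1 mul1r subrr.
have fB n : \sum_(k < n) (\sum_(i < s) p i k * f i k ^+ 2) / k.+1%:R ^+ 2 <= B.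
  by apply: le_trans (uB n); under eq_bigr do rewrite sum_sqr_centred.
have := strong_law hp0 hp1 hxi hxi_indep hxi_dist i0 f0 fB e0.
apply: filterS => t; apply: filterS => n.
by rewrite /f big_split/= sumrN.
Qed.

End Entropy.

(** * Typical masses and lengths of cylinders *)

Section LimInf.
Context {R : realType}.
Implicit Types (u : nat -> \bar R).

Lemma lt_limn_einf u (x : \bar R) :
  (x < limn_einf u)%E -> \forall n \near \oo, (x < u n)%E.
Proof.
rewrite limn_einf_lim (cvg_lim _ (@cvg_einfs_sup R u))// => /ereal_sup_gtP[y].
move=> [N _ <-] xN; exists N => // n /= Nn; apply: (lt_le_trans xN).
by apply: ereal_inf_lbound; exists n.
Qed.

Lemma limn_einf_lt u (x : \bar R) : (limn_einf u < x)%E ->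
  forall N, exists2 n, (N <= n)%N & (u n < x)%E.
Proof.
rewrite limn_einf_lim (cvg_lim _ (@cvg_einfs_sup R u))// => ux N.
have : (einfs u N < x)%E.
  by apply: le_lt_trans ux; apply: ereal_sup_ubound; exists N.
by move=> /ereal_inf_ltP[y [n /= Nn <-] unx]; exists n.
Qed.

End LimInf.

Section Typical.
Context {R : realType} {s : nat} (q p : 'I_s -> nat -> R).
Hypothesis hq : is_Qstar_matrix q.
Hypothesis hp0 : forall i k, 0 <= p i k.
Hypothesis hp1 : forall k, \sum_(i < s) p i k = 1.

Lemma ln_cylinder_length (u : 'I_s -> nat -> R) a n :
  (forall k, (k < n)%N -> 0 < u (a k) k) ->
  ln (cylinder_length u a n) = \sum_(k < n) ln (u (a k) k).
Proof.
elim: n => [|n ih] u0; first by rewrite /cylinder_length !big_ord0 ln1.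
rewrite cylinder_lengthS lnM ?posrE ?u0//; last first.
  by apply: prodr_gt0 => k _; exact/u0/leqW.
by rewrite big_ord_recr/= ih// => k kn; exact/u0/leqW.
Qed.

Lemma Qstar_length_gt0 a n : 0 < cylinder_length q a n.
Proof. by apply: prodr_gt0 => k _; case: hq. Qed.

(** Taking logarithms brings the comparison of a mass with a power of a length
    to sums, to which the strong law applies. *)
Lemma cylinder_mass_powR a (n : nat) (r : R) :
  (forall k, (k < n)%N -> 0 < p (a k) k) ->
  (cylinder_length p a n <= cylinder_length q a n `^ r) =
    (\sum_(k < n) ln (p (a k) k) <= r * \sum_(k < n) ln (q (a k) k)) /\
  (cylinder_length q a n `^ r <= cylinder_length p a n) =
    (r * \sum_(k < n) ln (q (a k) k) <= \sum_(k < n) ln (p (a k) k)).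
Proof.
move=> p0; have P0 : 0 < cylinder_length p a n.
  by apply: prodr_gt0 => k _; rewrite p0.
have L0 := Qstar_length_gt0 a n.
have lnL : ln (cylinder_length q a n `^ r) = r * \sum_(k < n) ln (q (a k) k).
  by rewrite ln_powR ln_cylinder_length// => k _; case: hq.
rewrite -lnL -(ln_cylinder_length p0).
by rewrite !ler_ln// posrE// powR_gt0.
Qed.

Hypothesis hB : (0 < limn_einf (fun n => (sum_cross_entropy p q n / n%:R)%:E))%E.

Lemma sum_cross_entropy_linear : exists2 c : R, 0 < c &
  \forall n \near \oo, (0 < n)%N /\ c * n%:R <= sum_cross_entropy p q n.
Proof.
have [c c0 hc] : exists2 c : R, 0 < c & (c%:E <
    limn_einf (fun n => (sum_cross_entropy p q n / n%:R)%:E))%E.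
  move: hB; case: (limn_einf _) => [r| |]//; rewrite ?lte_fin.
    by move=> r0; exists (r / 2); rewrite ?divr_gt0// lte_fin; lra.
  by move=> _; exists 1 => //; rewrite ltry.
exists c => //; have := lt_limn_einf hc.
move=> [N _ hN]; exists N.+1 => // n /= Nn.
have n0 : (0 < n)%N by exact: leq_ltn_trans Nn.
split => //; have := hN n (ltnW Nn); rewrite /= lte_fin.
by rewrite ltr_pdivlMr ?ltr0n// => /ltW.
Qed.

Lemma entropy_gap_below (r : R) :
  (r%:E < limn_einf (fun n => (sum_entropy p n / sum_cross_entropy p q n)%:E))%E ->
  exists2 c : R, 0 < c & \forall n \near \oo,
    (0 < n)%N /\ c * n%:R <= sum_entropy p n - r * sum_cross_entropy p q n.
Proof.
move=> rD; have [r' rr' r'D] : exists2 r' : R, r < r' & (r'%:E <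
    limn_einf (fun n => (sum_entropy p n / sum_cross_entropy p q n)%:E))%E.
  move: rD; case: (limn_einf _) => [x| |]//; rewrite ?lte_fin.
    by move=> rx; exists ((r + x) / 2); rewrite ?lte_fin; lra.
  by move=> _; exists (r + 1); [lra|rewrite ltry].
have [c c0 hc] := sum_cross_entropy_linear.
exists ((r' - r) * c); first by rewrite mulr_gt0// subr_gt0.
have := lt_limn_einf r'D; apply: filterS2 hc => n [n0 cn].
have B0 : 0 < sum_cross_entropy p q n.
  by apply: lt_le_trans cn; rewrite mulr_gt0// ltr0n.
rewrite lte_fin ltr_pdivlMr// => Hn; split=> //.
have : (r' - r) * (c * n%:R) <= (r' - r) * sum_cross_entropy p q n.
  by rewrite ler_wpM2l// subr_ge0 ltW.
by lra.
Qed.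

Lemma entropy_gap_above (r : R) :
  (limn_einf (fun n => (sum_entropy p n / sum_cross_entropy p q n)%:E) < r%:E)%E ->
  exists2 c : R, 0 < c & forall N, exists2 n, (N <= n)%N &
    (0 < n)%N /\ sum_entropy p n - r * sum_cross_entropy p q n <= - (c * n%:R).
Proof.
move=> rD; have [r' r'r r'D] : exists2 r' : R, r' < r & (limn_einf
    (fun n => (sum_entropy p n / sum_cross_entropy p q n)%:E) < r'%:E)%E.
  move: rD; case: (limn_einf _) => [x| |]//; rewrite ?lte_fin.
    by move=> rx; exists ((r + x) / 2); rewrite ?lte_fin; lra.
  by move=> _; exists (r - 1); [lra|rewrite ltNyr].
have [c c0 [M _ hM]] := sum_cross_entropy_linear.
exists ((r - r') * c); first by rewrite mulr_gt0// subr_gt0.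
move=> N; have [n] := limn_einf_lt r'D (maxn N M).
rewrite geq_max => /andP[Nn /hM/=[n0 cn]] Hn; exists n => //; split=> //.
have B0 : 0 < sum_cross_entropy p q n.
  by apply: lt_le_trans cn; rewrite mulr_gt0// ltr0n.
move: Hn; rewrite lte_fin ltr_pdivrMr// => Hn.
have : (r - r') * (c * n%:R) <= (r - r') * sum_cross_entropy p q n.
  by rewrite ler_wpM2l// subr_ge0 ltW.
by lra.
Qed.

Context {d : measure_display} {T : measurableType d} (P : probability T R).
Context (xi : nat -> T -> 'I_s).
Hypothesis hxi : forall k, discrete_RV (xi k).
Hypothesis hxi_indep : independent_discrete_RVs P xi.
Hypothesis hxi_dist : forall k i, P (xi k @^-1` [set i]) = (p i k)%:E.

Lemma ae_digit_prob_gt0 : {ae P, forall t, forall k, 0 < p (xi k t) k}.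
Proof.
apply/ae_foralln => k; exists (xi k @^-1` [set i | p i k <= 0]); split.
- exact: hxi.
- pose S := [pred i : 'I_s | p i k <= 0].
  apply/eqP; rewrite eq_le measure_ge0 andbT.
  apply: (@le_trans _ _ (\sum_(i \in [set` S]) P (xi k @^-1` [set i]))%E).
    apply: content_sub_fsum => //; [|exact: hxi|].
      by move=> i _; exact: hxi.
    by move=> t /= pt; exists (xi k t).
  rewrite fsbig1// => i /=; rewrite inE => pi0; rewrite hxi_dist.
  by congr EFin; apply/eqP; rewrite eq_le pi0 hp0.
- by move=> t /= /negP; rewrite -leNgt.
Qed.

Hypothesis hd : (\sum_(j <oo) (log_variance p q j / j.+1%:R ^+ 2)%:E < +oo)%E.

Let log_varianceE k : log_variance p q k =
  \sum_(i < s) p i k * ln (q i k) ^+ 2 - (\sum_(i < s) p i k * ln (q i k)) ^+ 2.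
Proof. by rewrite /log_variance /cross_entropy sqrrN addrC. Qed.

Let log_variance_ge0 k : 0 <= log_variance p q k.
Proof.
rewrite log_varianceE -(sum_sqr_centred hp1 (fun i j => ln (q i j)) k).
by apply: sumr_ge0 => i _; rewrite mulr_ge0// sqr_ge0.
Qed.

(** The variance of [ln (q (xi k) k)] is [log_variance p q k]. *)
Lemma strong_law_length (i0 : 'I_s) (e : R) : 0 < e ->
  {ae P, forall t, \forall n \near \oo,
    `|\sum_(k < n) ln (q (xi k t) k) + sum_cross_entropy p q n| < e * n%:R}.
Proof.
move=> e0; pose B := fine (\sum_(j <oo) (log_variance p q j / j.+1%:R ^+ 2)%:E)%E.
have term_ge0 k : (0 <= (log_variance p q k / k.+1%:R ^+ 2)%:E)%E.
  by rewrite lee_fin divr_ge0.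
have hB' n : \sum_(k < n) (\sum_(i < s) p i k * ln (q i k) ^+ 2 -
     (\sum_(i < s) p i k * ln (q i k)) ^+ 2) / k.+1%:R ^+ 2 <= B.
  under eq_bigr do rewrite -log_varianceE.
  rewrite -lee_fin fineK; last first.
    by rewrite ge0_fin_numE// nneseries_ge0.
  rewrite -sumEFin -(big_mkord predT
    (fun k => (log_variance p q k / k.+1%:R ^+ 2)%:E)).
  exact: nneseries_lim_ge.
have := strong_law_uncentred hp0 hp1 hxi hxi_indep hxi_dist i0
  (u := fun i k => ln (q i k)) hB' e0.
apply: filterS => t; apply: filterS => n.
by rewrite /sum_cross_entropy /cross_entropy sumrN.
Qed.

(** Whatever the probabilities, each variance is at most [4 * s]. *)
Lemma strong_law_mass (i0 : 'I_s) (e : R) : 0 < e ->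
  {ae P, forall t, \forall n \near \oo,
    `|\sum_(k < n) ln (p (xi k t) k) + sum_entropy p n| < e * n%:R}.
Proof.
move=> e0.
have hB' n : \sum_(k < n) (\sum_(i < s) p i k * ln (p i k) ^+ 2 -
     (\sum_(i < s) p i k * ln (p i k)) ^+ 2) / k.+1%:R ^+ 2 <=
     s%:R * 4 * 2.
  apply: (@le_trans _ _ (\sum_(k < n) s%:R * 4 * k.+1%:R ^- 2)).
    apply: ler_sum => k _; rewrite ler_wpM2r//.
    rewrite lerBlDr -[leLHS]addr0 lerD ?sqr_ge0//.
    apply: (@le_trans _ _ (\sum_(i < s) 4)).
      apply: ler_sum => i _; apply: mul_ln_sqr_le4.
      by rewrite hp0 (le1_prob hp0 hp1).
    by rewrite sumr_const card_ord mulr_natl.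
  by rewrite -mulr_sumr ler_wpM2l// sum_inv_sqr_le2.
have := strong_law_uncentred hp0 hp1 hxi hxi_indep hxi_dist i0
  (u := fun i k => ln (p i k)) hB' e0.
apply: filterS => t; apply: filterS => n.
by rewrite /sum_entropy /entropy sumrN.
Qed.

Lemma strong_law_combined (i0 : 'I_s) (r e : R) : 0 < e ->
  {ae P, forall t, \forall n \near \oo,
    `|\sum_(k < n) ln (p (xi k t) k) - r * \sum_(k < n) ln (q (xi k t) k) +
      (sum_entropy p n - r * sum_cross_entropy p q n)| < e * n%:R}.
Proof.
move=> e0; pose e' := e / 2 / (`|r| + 1).
have r1 : 0 < `|r| + 1 by rewrite ltr_wpDl.
have e20 : 0 < e / 2 by rewrite divr_gt0.
have e'0 : 0 < e' by rewrite divr_gt0.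
apply: filterS2 (strong_law_mass i0 e20) (strong_law_length i0 e'0) => t.
apply: filterS2 => n hP hL.
set x := \sum_(k < n) _ in hP *; set y := \sum_(k < n) _ in hL *.
have -> : x - r * y + (sum_entropy p n - r * sum_cross_entropy p q n) =
  (x + sum_entropy p n) - r * (y + sum_cross_entropy p q n) by ring.
apply: (le_lt_trans (ler_normB _ _)); rewrite normrM.
have : `|r| * `|y + sum_cross_entropy p q n| <= (`|r| + 1) * (e' * n%:R).
  by rewrite ler_pM// ?(ltW hL)// lerDl.
have -> : (`|r| + 1) * (e' * n%:R) = e / 2 * n%:R.
  by rewrite mulrA /e' [_ * (e / 2 / _)]mulrC divfK// gt_eqF.
by lra.
Qed.

(** The gap between [H_n] and [r * B_n] is at least linear in [n], for all large
    [n] if [r] is below the limit inferior and for infinitely many [n] if [r] is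
    above it. The fluctuations are [o(n)], so that the sign of the gap decides
    the comparison. *)
Lemma ae_mass_le (i0 : 'I_s) (r : R) :
  (r%:E < limn_einf (fun n => (sum_entropy p n / sum_cross_entropy p q n)%:E))%E ->
  {ae P, forall t, \forall n \near \oo, cylinder_length p (xi ^~ t) n <=
    cylinder_length q (xi ^~ t) n `^ r}.
Proof.
move=> /entropy_gap_below[c c0 gap].
apply: filterS2 ae_digit_prob_gt0 (strong_law_combined i0 r c0) => t p0.
move=> sl; near=> n.
have [-> _] := @cylinder_mass_powR (xi ^~ t) n r (fun k _ => p0 k).
have : `|\sum_(k < n) ln (p (xi k t) k) - r * \sum_(k < n) ln (q (xi k t) k) +
    (sum_entropy p n - r * sum_cross_entropy p q n)| < c * n%:R by near: n.
have : (0 < n)%N /\ c * n%:R <= sum_entropy p n - r * sum_cross_entropy p q n.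
  by near: n.
by move=> [_ h1]; rewrite ltr_norml => /andP[_]; lra.
Unshelve. all: by end_near. Qed.

Lemma ae_mass_ge (i0 : 'I_s) (r : R) :
  (limn_einf (fun n => (sum_entropy p n / sum_cross_entropy p q n)%:E) < r%:E)%E ->
  {ae P, forall t, forall N, exists2 n, (N <= n)%N &
    cylinder_length q (xi ^~ t) n `^ r <= cylinder_length p (xi ^~ t) n}.
Proof.
move=> /entropy_gap_above[c c0 gap].
apply: filterS2 ae_digit_prob_gt0 (strong_law_combined i0 r c0) => t p0.
move=> [M _ sl] N; have [n nNM [_ h1]] := gap (maxn N M).
move: nNM; rewrite geq_max => /andP[Nn Mn]; exists n => //.
have [_ ->] := @cylinder_mass_powR (xi ^~ t) n r (fun k _ => p0 k).
by have := sl n Mn; rewrite /= ltr_norml => /andP[+ _]; lra.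
Qed.

End Typical.

(** * Hausdorff measure *)

Section HausdorffFacts.
Context {R : realType}.
Implicit Types (A E : set R).
Local Open Scope ereal_scope.

Lemma diameter_ge A x y : A x -> A y -> `|x - y|%:E <= diameter A.
Proof. by move=> Ax Ay; apply: ereal_sup_ubound; exists (x, y). Qed.

Lemma diameter_ge0 A : A !=set0 -> 0 <= diameter A.
Proof. by move=> [x Ax]; have := diameter_ge Ax Ax; rewrite subrr normr0. Qed.

Lemma diameter_itv_le (x l : R) : diameter `[x, (x + l)%R] <= l%:E.
Proof.
apply: ge_ereal_sup => _ [[y z]] /= [+ +] <-; rewrite !in_itv/= lee_fin ler_norml.
by move=> /andP[? ?] /andP[? ?]; apply/andP; split; lra.
Qed.

Lemma diameter_pow_ge0 a A : 0 <= diameter_pow a A.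
Proof. by rewrite /diameter_pow; case: ifP => // _; exact: poweR_ge0. Qed.

Lemma diameter_pow_itv_le a (x l : R) : (0 <= a)%R -> (0 <= l)%R ->
  diameter_pow a `[x, (x + l)%R] <= (l `^ a)%:E.
Proof.
move=> a0 l0; have ne : `[x, (x + l)%R] !=set0.
  by exists x; rewrite /= in_itv/= lexx lerDl.
rewrite /diameter_pow; case: eqP => [E0|_].
  by move: ne; rewrite E0 => -[].
rewrite -poweR_EFin gt0_ler_poweR ?in_itv/= ?leey ?andbT//; last first.
  exact: diameter_itv_le.
exact: diameter_ge0.
Qed.

Lemma hausdorff_premeasure_ge0 a e E : 0 <= hausdorff_premeasure a e E.
Proof.
apply: le_ereal_inf_tmp => _ [A _ <-].
by apply: nneseries_ge0 => n _ _; exact: diameter_pow_ge0.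
Qed.

(** The covers in the definition of the measure are sequences, whereas natural
    families are indexed by words; any countable type of indices will do. *)
Lemma hausdorff_measure_eq0 (I : countType) (B : I -> set R) a E :
  (forall e eps : R, (0 < e)%R -> (0 < eps)%R -> exists C : set I,
    [/\ forall i, C i -> diameter (B i) <= e%:E,
        E `<=` \bigcup_(i in C) B i &
        \esum_(i in C) diameter_pow a (B i) <= eps%:E]) ->
  hausdorff_measure a E = 0.
Proof.
move=> h; apply/eqP; rewrite eq_le; apply/andP; split; last first.
  apply: le_trans (hausdorff_premeasure_ge0 a 1 E) _.
  by apply: ereal_sup_ubound; exists 1%R => //=.
apply: ge_ereal_sup => _ [e /= e0 <-].
apply/lee_addgt0Pr => eps eps0; rewrite add0e.
have [C [Ce EC Ceps]] := h _ _ e0 eps0.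
(* The indices outside [C] are filled with empty sets, which contribute [0] to
   the sum even in dimension [0]. *)
pose A (k : nat) : set R :=
  if (pickle_inv k : option I) is Some i then
    (if i \in C then B i else set0)
  else set0.
have pw0 : diameter_pow a (set0 : set R) = 0 by rewrite /diameter_pow eqxx.
apply: (@le_trans _ _ (\sum_(k <oo) diameter_pow a (A k))).
  apply: ereal_inf_lbound; exists A => //; split.
    move=> k; rewrite /A; case: (pickle_inv k : option I) => [i|].
      case: ifPn => [/set_mem/Ce//|_].
      by rewrite /diameter set0X image_set0 ereal_sup0 leNye.
    by rewrite /diameter set0X image_set0 ereal_sup0 leNye.
  move=> x /EC[i Ci Bx]; exists (choice.pickle i) => //.
  by rewrite /A pickleK_inv mem_set.
apply: le_trans Ceps; rewrite nneseries_esumT; last first.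
  by move=> k; exact: diameter_pow_ge0.
have pinj : set_inj C choice.pickle.
  by move=> i j _ _; exact: (pcan_inj choice.pickleK).
rewrite [leRHS](_ : _ = \esum_(k in choice.pickle @` C) diameter_pow a (A k)).
  rewrite [leRHS]esum_mkcond; apply: le_esum => k _.
  case: ifPn => // /negP kC; rewrite /A.
  case kE : (pickle_inv k : option I) => [i|]; last by rewrite pw0.
  case: ifPn => [Ci|]; last by rewrite pw0.
  exfalso; apply: kC; rewrite inE; exists i; first exact: set_mem.
  by have := @pickle_invK I k; rewrite kE.
rewrite esum_image//; apply: eq_esum => i Ci.
by rewrite /A pickleK_inv mem_set.
Qed.

(** With a mesh below [1 / 2], intervals of twice the diameter of a set of the
    cover are still shorter than [[0, 1]]. *)
Lemma hausdorff_measure_eq0_cover a E (eps : R) :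
  hausdorff_measure a E = 0 -> (0 < eps)%R ->
  exists A : nat -> set R, [/\ forall i, diameter (A i) <= (4^-1)%:E,
    E `<=` \bigcup_i A i & \sum_(i <oo) diameter_pow a (A i) < eps%:E].
Proof.
move=> H0 eps0.
have : hausdorff_premeasure a 4^-1 E < eps%:E.
  apply: (@le_lt_trans _ _ 0); last by rewrite lte_fin.
  by rewrite -H0; apply: ereal_sup_ubound; exists 4^-1%R => //=; rewrite invr_gt0.
by move=> /ereal_inf_ltP[_ [A [A1 A2] <-] A3]; exists A.
Qed.

End HausdorffFacts.

(** * Position of the cylinders *)

Section Geometry.
Context {R : realType} {s : nat} (q : 'I_s -> nat -> R).
Hypothesis hq : is_Qstar_matrix q.
Implicit Types a b : nat -> 'I_s.

Let right a n := cylinder_left q a n + cylinder_length q a n.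

Let le_left a m n : (m <= n)%N -> cylinder_left q a m <= cylinder_left q a n.
Proof.
have : nondecreasing_seq (cylinder_left q a).
  by apply/nondecreasing_seqP => k; exact: cylinder_left_nd.
by apply.
Qed.

Let ge_right a m n : (m <= n)%N -> right a n <= right a m.
Proof.
have : nonincreasing_seq (right a).
  by apply/nonincreasing_seqP => k; exact: cylinder_right_ni.
by apply.
Qed.

Let right_le_left a b n k : (k < n)%N -> (forall j, (j < k)%N -> a j = b j) ->
  (a k < b k)%N -> right a n <= cylinder_left q b n.
Proof.
move=> kn ab akbk; have [q0 _ _] := hq.
apply: le_trans (ge_right a kn) _; apply: le_trans (le_left b kn).
rewrite /right /= cylinder_lengthS -(eq_cylinder_left q ab).
rewrite -(eq_cylinder_length q ab) -addrA lerD2l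
  [cylinder_length q a k * _]mulrC -mulrDl ler_wpM2r//.
  exact: cylinder_length_ge0.
rewrite addrC (bigID (fun i : 'I_s => (i < a k)%N) (fun i : 'I_s => (i < b k)%N))/=.
rewrite addrC lerD//.
  rewrite le_eqVlt; apply/orP; left; apply/eqP; apply: eq_bigl => i.
  by case: (ltnP i (a k)) => [/ltn_trans->|]; rewrite ?andbF.
rewrite (bigD1 (a k))/= ?akbk ?ltnn// lerDl sumr_ge0// => i _.
exact/ltW/q0.
Qed.

(** At the first rank where the two sequences differ, the smaller digit gives
    the interval on the left; smaller cylinders are nested in these. *)
Lemma cylinder_right_le_left a b n : (exists2 k, (k < n)%N & a k != b k) ->
  cylinder_left q a n + cylinder_length q a n <= cylinder_left q b n \/
  cylinder_left q b n + cylinder_length q b n <= cylinder_left q a n.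
Proof.
move=> [k0 k0n abk0].
have ex : exists k, (k < n)%N && (a k != b k) by exists k0; rewrite k0n.
case: (ex_minnP ex) => k /andP[kn abk] kmin.
have ab j : (j < k)%N -> a j = b j.
  move=> jk; apply/eqP; apply: contraTT jk => abj; rewrite -leqNgt.
  have [jn|nj] := ltnP j n; first by rewrite kmin// jn.
  exact: leq_trans (ltnW kn) nj.
have [akbk|bkak|/val_inj abk'] := ltngtP (a k) (b k).
- by left; exact: right_le_left akbk.
- by right; apply: (right_le_left kn _ bkak) => j /ab.
- by rewrite abk' eqxx in abk.
Qed.

(** Of three intervals of length greater than [r] with disjoint interiors, the
    middle one separates the other two by more than [r]. *)
Lemma card_long_cylinders_le2 (i0 : 'I_s) n (r u v : R) : v - u <= r ->
  (#|[set w : n.-tuple 'I_s | (r < cylinder_length q (nth i0 w) n)%R &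
    (cylinder_left q (nth i0 w) n <= v)%R &&
    (u <= cylinder_left q (nth i0 w) n + cylinder_length q (nth i0 w) n)%R]%SET|
    <= 2)%N.
Proof.
move=> uvr; rewrite leqNgt; apply/negP => /card_gt2P.
move=> [w1 [w2 [w3 [[+ + +] [n12 n23 n31]]]]].
rewrite !inE => /and3P[r1 v1 u1] /and3P[r2 v2 u2] /and3P[r3 v3 u3].
have diff (w w' : n.-tuple 'I_s) : w != w' ->
    exists2 k, (k < n)%N & nth i0 w k != nth i0 w' k.
  move=> ww'; apply: contrapT => h; move/eqP: ww'; apply.
  apply: eq_from_tnth => k; rewrite !(tnth_nth i0).
  by apply/eqP/negPn/negP => wk; apply: h; exists k.
have := cylinder_right_le_left (diff _ _ n12).
have := cylinder_right_le_left (diff _ _ n23).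
have := cylinder_right_le_left (diff _ _ n31).
by move=> [?|?] [?|?] [?|?]; lra.
Qed.

Lemma cylinder_length_le_qmax a n :
  cylinder_length q a n <= \prod_(k < n) qmax q k.
Proof.
by have [q0 _ _] := hq; apply: ler_prod => k _; rewrite ltW ?q0//= qmax_ub.
Qed.

End Geometry.

(** * Lower bound for the dimension *)

Section Summability.
Context {R : realType} {s : nat} (q : 'I_s -> nat -> R).
Hypothesis hS : forall delta : R, 0 < delta -> (fineness q delta < +oo)%E.

(** This is the term [m = 0] of the supremum, up to the summand of rank [0]. *)
Lemma qmax_prod_powR_summable (delta : R) : 0 < delta ->
  (\sum_(n <oo) ((\prod_(k < n) qmax q k) `^ delta)%:E < +oo)%E.
Proof.
move=> d0; rewrite nneseries_recl//; last first.
  by move=> k; rewrite lee_fin powR_ge0.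
rewrite big_ord0 powR1 lte_add_pinfty ?ltry//.
apply: le_lt_trans (hS d0); apply: ereal_sup_ubound; exists 0%N => //.
rewrite -(nneseries_addn (f := fun n => ((\prod_(k < n) qmax q k) `^ delta)%:E)).
  by apply: eq_eseriesr => n _; rewrite addn1.
by move=> n; rewrite lee_fin powR_ge0.
Qed.

End Summability.

Section LowerBound.
Context {R : realType} {s : nat} (q p : 'I_s -> nat -> R).
Hypothesis hq : is_Qstar_matrix q.
Hypothesis hp0 : forall i k, 0 <= p i k.
Hypothesis hp1 : forall k, \sum_(i < s) p i k = 1.
Context {d : measure_display} {T : measurableType d} (P : probability T R).
Context (xi : nat -> T -> 'I_s).
Hypothesis hxi : forall k, discrete_RV (xi k).
Hypothesis hxi_indep : independent_discrete_RVs P xi.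
Hypothesis hxi_dist : forall k i, P (xi k @^-1` [set i]) = (p i k)%:E.
Hypothesis hS : forall delta : R, 0 < delta -> (fineness q delta < +oo)%E.

Let point t := Qstar_point q (xi ^~ t).

Definition mass_bounded (C r : R) : set T :=
  [set t | forall n, cylinder_length p (xi ^~ t) n <=
    C * cylinder_length q (xi ^~ t) n `^ r].

Lemma measurable_mass_bounded (i0 : 'I_s) C r : measurable (mass_bounded C r).
Proof.
rewrite (_ : mass_bounded C r = \bigcap_n [set t |
    cylinder_length p (nth i0 (digits xi n t)) n <=
    C * cylinder_length q (nth i0 (digits xi n t)) n `^ r]); last first.
  have E u t n : cylinder_length u (nth i0 (digits xi n t)) n =
      cylinder_length u (xi ^~ t) n :> R.
    by apply: eq_cylinder_length => k kn; rewrite nth_digits.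
  by apply/seteqP; split => t /= h n => [_|]; have := h n; rewrite /= !E//; apply.
apply: bigcap_measurable => // n _.
exact: (measurable_digits hxi (fun w => cylinder_length p (nth i0 w) n <=
    C * cylinder_length q (nth i0 w) n `^ r)).
Qed.

(** A constant depending on the point takes care of the finitely many first
    ranks. Countably many constants exhaust almost all points, so that one of
    them works with positive probability. *)
Lemma mass_bounded_pos (i0 : 'I_s) (r : R) :
  {ae P, forall t, \forall n \near \oo, cylinder_length p (xi ^~ t) n <=
    cylinder_length q (xi ^~ t) n `^ r} ->
  exists C : nat, (0 < P (mass_bounded C%:R r))%E.
Proof.
move=> [N [mN N0 hN]]; apply: contrapT => /forallNP h.
have mB C := measurable_mass_bounded i0 C r.
have neg0 : P.-negligible (\bigcup_(C : nat) mass_bounded C%:R r).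
  apply: negligible_bigcup => C; apply/negligibleP => //.
  by apply/eqP; rewrite eq_le measure_ge0 andbT leNgt; apply/negP/h.
have negN : P.-negligible N by apply/negligibleP.
have : P.-negligible setT.
  apply: negligibleS (negligibleU neg0 negN) => t _.
  have [Nt|Nt] := pselect (N t); [by right|left].
  have : \forall n \near \oo, cylinder_length p (xi ^~ t) n <=
      cylinder_length q (xi ^~ t) n `^ r.
    by apply: contrapT => /hN.
  move=> [M _ hM].
  pose L k := cylinder_length q (xi ^~ t) k `^ r.
  have L0 k : 0 < L k by apply/powR_gt0/Qstar_length_gt0.
  pose x := 1 + \sum_(k < M) (L k)^-1.
  exists (Num.truncn x).+1 => //= n; rewrite -/(L n).
  have xC : x <= (Num.truncn x).+1%:R by exact/ltW/truncnS_gt.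
  have x1 : 1 <= x by rewrite lerDl sumr_ge0// => k _; rewrite invr_ge0 ltW.
  have [nM|Mn] := ltnP n M; last first.
    apply: (le_trans (hM n Mn)); rewrite ler_peMl ?(ltW (L0 n))//.
    exact: le_trans x1 xC.
  apply: (@le_trans _ _ 1).
    by apply: prodr_ile1 => k _; rewrite hp0 (le1_prob hp0 hp1).
  rewrite -ler_pdivrMr// div1r; apply: le_trans xC.
  rewrite /x (bigD1 (Ordinal nM))//= addrCA lerDl.
  by rewrite addr_ge0// sumr_ge0// => k _; rewrite invr_ge0 ltW.
move=> /(measure_negligible measurableT).
move=> PT0; have := probability_setT P; rewrite PT0.
by move=> /eqP; rewrite eq_sym onee_eq0.
Qed.

(** The key estimate. Stop at the first rank where the length drops to [r] or
    below. The cylinder of the previous rank is longer than [r], so that at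
    most two of them meet the interval; as each has [s] children, all of length
    at most [r], a rank contributes at most [2 * s * C * r `^ (alpha + delta)].
    Only ranks at which the maximal length exceeds [r] contribute, which is
    where the factor [r `^ delta] is traded for a summable one. *)
Lemma interval_mass_le (i0 : 'I_s) (C K alpha delta r u v : R) :
  0 <= C -> 0 <= alpha -> 0 < delta ->
  (\sum_(n <oo) ((\prod_(k < n) qmax q k) `^ delta)%:E <= K%:E)%E ->
  0 < r < 1 -> v - u <= r ->
  (P ([set t | (u <= point t <= v)%R] `&` mass_bounded C (alpha + delta)) <=
    (2 * s%:R * C * K * r `^ alpha)%:E)%E.
Proof.
move=> C0 alpha0 delta0 hK /andP[r0 r1] uvr.
set M := fun n => \prod_(k < n) qmax q k.
pose W n : {set n.-tuple 'I_s} :=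
  [set w : n.-tuple 'I_s | (r < cylinder_length q (nth i0 w) n)%R &
    (cylinder_left q (nth i0 w) n <= v)%R &&
    (u <= cylinder_left q (nth i0 w) n + cylinder_length q (nth i0 w) n)%R]%SET.
pose ok n (x : n.-tuple 'I_s * 'I_s) := (x.1 \in W n) &&
  (cylinder_length p (nth i0 (rcons x.1 x.2)) n.+1 <= C * r `^ (alpha + delta)).
(* The stopping rank is [n.+1]: the pair consists of the word of rank [n] and
   the digit at which the length drops to [r] or below. *)
pose F n := [set t | exists x : n.-tuple 'I_s * 'I_s,
  ok n x /\ digits xi n.+1 t = rcons x.1 x.2].
have mF n : measurable (F n).
  exact: (measurable_digits hxi (fun w => exists x : n.-tuple 'I_s * 'I_s,
    ok n x /\ w = rcons x.1 x.2)).
have PF n : (P (F n) <= (2 * s%:R * C * r `^ alpha * M n `^ delta)%:E)%E.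
  apply: le_trans (probability_le_sum_words hxi hxi_indep hxi_dist i0
    (S := ok n) (w := fun x => rcons x.1 x.2) (mF n) _) _.
    move=> t [x [okx tx]]; exists x => //.
    by rewrite /word_event/= size_rcons size_tuple.
  rewrite lee_fin.
  apply: (@le_trans _ _ (\sum_(x | ok n x) C * r `^ (alpha + delta))).
    apply: ler_sum => x /andP[_]; rewrite size_rcons size_tuple.
    exact.
  rewrite sumr_const -[leLHS]mulr_natl; set c := #|_|.
  have [Mr|rM] := leP (M n) r.
    (* No cylinder of rank [n] is longer than [r]. *)
    have -> : c = 0%N; last by rewrite mul0r !mulr_ge0 ?powR_ge0.
      apply: eq_card0 => x; rewrite unfold_in /= inE ltNge (le_trans _ Mr)//.
      exact: cylinder_length_le_qmax.
  have card_ok : (c <= 2 * s)%N.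
    apply: (@leq_trans #|finset.setX (W n) [set: 'I_s]%SET|).
      apply/subset_leq_card/fintype.subsetP => -[w i] /andP[/= xW _].
      by rewrite finset.in_setX xW finset.in_setT.
    rewrite cardsX cardsT card_ord leq_mul2r.
    by apply/orP; right; exact: (card_long_cylinders_le2 hq i0 n uvr).
  rewrite powRD; last by rewrite (gt_eqF r0) implybT.
  have rM' : r `^ delta <= M n `^ delta.
    by rewrite ge0_ler_powR ?nnegrE ?ltW//; apply: lt_trans rM.
  have card_okR : (c%:R : R) <= 2 * s%:R by rewrite -natrM ler_nat.
  have -> : c%:R * (C * (r `^ alpha * r `^ delta)) =
    (c%:R * r `^ delta) * (C * r `^ alpha) by ring.
  have -> : 2 * s%:R * C * r `^ alpha * M n `^ delta =
    (2 * s%:R * M n `^ delta) * (C * r `^ alpha) by ring.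
  rewrite ler_wpM2r ?mulr_ge0 ?powR_ge0//.
  by rewrite ler_pM ?powR_ge0.
apply: (@le_trans _ _ (\sum_(n <oo) P (F n))%E).
  apply: measure_sigma_subadditive => //.
    apply: measurableI; last exact: measurable_mass_bounded.
    rewrite (_ : [set t | _] = setT `&` point @^-1` `[u, v]).
      exact: (measurable_Qstar_point hq hxi).
    by apply/seteqP; split => t /=; rewrite in_itv/=; [split|case].
  move=> t [/= /andP[ut tv] tC].
  have ex : exists n, cylinder_length q (xi ^~ t) n <= r.
    have /cvgrPdist_le/(_ _ r0)[n _ hn] := cvg_cylinder_length (xi ^~ t) hq.
    exists n; have := hn n (leqnn n).
    by rewrite /= sub0r normrN ger0_norm// cylinder_length_ge0.
  case: (ex_minnP ex) => -[|n] nr nmin.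
    by move: nr; rewrite /cylinder_length big_ord0 leNgt r1.
  exists n => //; pose w := Tuple (introT eqP (size_digits xi n t)).
  have wE k : (k < n)%N -> nth i0 w k = xi k t by exact: nth_digits.
  exists (w, xi n t); split; last exact: digitsS.
  have xE k : (k < n.+1)%N -> nth i0 (rcons w (xi n t)) k = xi k t.
    by rewrite -digitsS; exact: nth_digits.
  apply/andP; split.
    rewrite inE /= (eq_cylinder_length q wE) (eq_cylinder_left q wE).
    rewrite ltNge; apply/and3P; split.
    - by apply/negP => /nmin; rewrite ltnn.
    - have := Qstar_pointP (xi ^~ t) n hq; rewrite /cylinder/= in_itv/=.
      by move=> /andP[/le_trans + _]; apply.
    - have := Qstar_pointP (xi ^~ t) n hq; rewrite /cylinder/= in_itv/=.
      by move=> /andP[_]; apply: le_trans.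
  rewrite /= (eq_cylinder_length p xE); apply: (le_trans (tC n.+1)).
  rewrite ler_wpM2l// ge0_ler_powR ?nnegrE ?addr_ge0 ?(ltW r0) ?(ltW delta0)//.
  exact: cylinder_length_ge0.
apply: (@le_trans _ _ (\sum_(n <oo)
    (2 * s%:R * C * r `^ alpha)%:E * (M n `^ delta)%:E)%E).
  by apply: lee_nneseries => // n _; rewrite -EFinM.
rewrite nneseriesZl//; last by move=> n _; rewrite lee_fin powR_ge0.
apply: (@le_trans _ _ ((2 * s%:R * C * r `^ alpha)%:E * K%:E)%E).
  by rewrite lee_wpmul2l// lee_fin !mulr_ge0// powR_ge0.
by rewrite -EFinM lee_fin mulrAC.
Qed.


(** A set may have diameter [0]; the previous estimate is then applied with
    intervals of length tending to [0]. *)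
Lemma diameter_mass_le (i0 : 'I_s) (C alpha r : R) :
  0 <= C -> 0 <= alpha < r ->
  exists2 K : R, 0 < K & forall A : set R, (diameter A <= (4^-1)%:E)%E ->
    exists J : set R, [/\ measurable J, A `<=` J &
      (P (point @^-1` J `&` mass_bounded C r) <=
        K%:E * diameter_pow alpha A)%E].
Proof.
move=> C0 /andP[alpha0 alphar].
pose delta := r - alpha; have delta0 : 0 < delta by rewrite subr_gt0.
have rE : r = alpha + delta by rewrite /delta addrC subrK.
pose S := (\sum_(n <oo) ((\prod_(k < n) qmax q k) `^ delta)%:E)%E.
have S0 : (0 <= S)%E.
  by apply: nneseries_ge0 => n _ _; rewrite lee_fin powR_ge0.
have SE : S = (fine S)%:E.
  by rewrite fineK// ge0_fin_numE//; exact: qmax_prod_powR_summable.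
have S_le : (S <= (fine S)%:E)%E by rewrite {1}SE.
pose K0 := 2 * s%:R * C * fine S.
have K00 : 0 <= K0 by rewrite !mulr_ge0 ?fine_ge0.
have main u v x : 0 < x < 1 -> v - u <= x ->
    (P (point @^-1` `[u, v] `&` mass_bounded C r) <= (K0 * x `^ alpha)%:E)%E.
  move=> x01 uvx; have := interval_mass_le i0 C0 alpha0 delta0 S_le x01 uvx.
  have -> : point @^-1` `[u, v] = [set t | u <= point t <= v].
    by apply/seteqP; split => t /=; rewrite in_itv.
  by rewrite -rE.
have mpoint (J : set R) : measurable J -> measurable (point @^-1` J).
  by move=> mJ; rewrite -[X in measurable X]setTI;
    exact: (measurable_Qstar_point hq hxi).
have mG := measurable_mass_bounded i0 C r.
exists (K0 * 2 `^ alpha + 1).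
  by rewrite ltr_wpDl// mulr_ge0// powR_ge0.
move=> A dA; have [->|/set0P A0] := eqVneq A set0.
  exists set0; split => //; rewrite preimage_set0 set0I measure0.
  by rewrite mule_ge0 ?diameter_pow_ge0// lee_fin addr_ge0// mulr_ge0// powR_ge0.
have dA0 := diameter_ge0 A0.
have dAE : diameter A = (fine (diameter A))%:E.
  by rewrite fineK// ge0_fin_numE// (le_lt_trans dA)// ltry.
set D := fine (diameter A) in dAE.
have D0 : 0 <= D by rewrite -lee_fin -dAE.
have D4 : D <= 4^-1 by rewrite -lee_fin -dAE.
have powE : diameter_pow alpha A = (D `^ alpha)%:E.
  by rewrite /diameter_pow dAE; case: eqP A0 => [->|//] -[].
(* Whichever point of [A] is the centre, an interval of twice the diameter
   contains [A]. *)
case: (A0) => x Ax; exists `[x - D, x + D]%classic; split => //.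
  move=> y Ay /=; rewrite in_itv/=.
  have : `|y - x| <= D by rewrite -lee_fin -dAE diameter_ge.
  by rewrite ler_distl.
rewrite powE -EFinM.
have [D00|Dn0] := eqVneq D 0; last first.
  have Dgt0 : 0 < D by rewrite lt_neqAle eq_sym Dn0.
  apply: (@le_trans _ _ (K0 * (2 * D) `^ alpha)%:E).
    by apply: main; [apply/andP; split; lra|lra].
  by rewrite lee_fin powRM// mulrDl mulrA lerDl mul1r powR_ge0.
(* For [D = 0], the convention for the power of the diameter is [1] in
   dimension [0], and any probability is at most [1]. *)
have [a0|an0] := eqVneq alpha 0.
  rewrite a0 !powRr0 mulr1 mulr1; apply: (@le_trans _ _ 1%E).
    by apply: probability_le1; apply: measurableI => //; exact: mpoint.
  by rewrite lee_fin lerDr.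
rewrite D00 powR0// mulr0 subr0 addr0.
apply/lee_addgt0Pr => e e0; rewrite add0e.
have alphagt0 : 0 < alpha by rewrite lt_neqAle eq_sym an0.
have cv : K0 * x `^ alpha @[x --> 0^'+] --> 0.
  rewrite -[X in _ --> X](mulr0 K0); apply: cvgMr.
  exact: powR_cvg0.
have [y [y0 y1 ye]] : exists y, [/\ 0 < y, y < 1 & K0 * y `^ alpha <= e].
  have /cvgrPdist_le/(_ _ e0) small := cv.
  have [y [[y0 y1] ye]] := filter_ex
    (filterI (filterI (nbhs_right_gt 0) (nbhs_right_lt ltr01)) small).
  exists y; split => //; move: ye; rewrite /= sub0r normrN.
  by rewrite ger0_norm// mulr_ge0// powR_ge0.
apply: (@le_trans _ _ (K0 * y `^ alpha)%:E); last by rewrite lee_fin.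
by apply: main; [rewrite y0|rewrite subrr ltW].
Qed.

(** The mass distribution principle: if the set carries the whole mass, then
    the sets of a cover carry at least the positive mass of a set
    on which masses are bounded, so that the sums over covers are bounded away
    from [0]. *)
Lemma hausdorff_measure_neq0 (i0 : 'I_s) (alpha r : R) (E : set R) :
  0 <= alpha < r ->
  {ae P, forall t, \forall n \near \oo, cylinder_length p (xi ^~ t) n <=
    cylinder_length q (xi ^~ t) n `^ r} ->
  measurable E -> P (point @^-1` E) = 1%E -> hausdorff_measure alpha E != 0%E.
Proof.
move=> alphar /(mass_bounded_pos i0)[C PC] mE PE; apply/eqP => H0.
have [K K0 hK] := diameter_mass_le i0 (ler0n _ C) alphar.
set G := mass_bounded C%:R r in PC hK.
have mG : measurable G := measurable_mass_bounded i0 C%:R r.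
have mpoint (J : set R) : measurable J -> measurable (point @^-1` J).
  by move=> mJ; rewrite -[X in measurable X]setTI;
    exact: (measurable_Qstar_point hq hxi).
have : (P G <= 0)%E; last by rewrite leNgt PC.
apply/lee_addgt0Pr => e e0; rewrite add0e.
have eK0 : 0 < e / K by rewrite divr_gt0.
have [A [Ad EA Ae]] := hausdorff_measure_eq0_cover H0 eK0.
pose J i := sval (cid (hK (A i) (Ad i))).
have hJ i := svalP (cid (hK (A i) (Ad i))).
have mJ i : measurable (J i) by case: (hJ i).
apply: (@le_trans _ _ (P (point @^-1` E `&` G))).
  have mE' := mpoint _ mE.
  have PEC : P (~` (point @^-1` E)) = 0%E by rewrite probability_setC// PE subee.
  rewrite -[leRHS]adde0 -PEC; apply: le_trans (measureU2 _ _ _).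
  - apply: le_measure; rewrite ?inE//.
      by apply: measurableU; [exact: measurableI|exact: measurableC].
    by move=> t Gt; have [Et|Et] := pselect (E (point t)); [left|right].
  - exact: measurableI.
  - exact: measurableC.
apply: (@le_trans _ _ (\sum_(i <oo) P (point @^-1` (J i) `&` G))%E).
  apply: measure_sigma_subadditive.
  - by move=> i; apply: measurableI => //; exact: mpoint.
  - by apply: measurableI => //; exact: mpoint.
  - move=> t [/EA[i _ Ait] Gt]; exists i => //; split => //.
    by case: (hJ i) => _ + _; apply.
apply: (@le_trans _ _ (\sum_(i <oo) K%:E * diameter_pow alpha (A i))%E).
  by apply: lee_nneseries => // i _; case: (hJ i).
rewrite nneseriesZl//; last by move=> i _; exact: diameter_pow_ge0.
apply: (@le_trans _ _ (K%:E * (e / K)%:E)%E).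
  by rewrite lee_wpmul2l ?lee_fin ?(ltW K0)// ltW.
by rewrite -EFinM lee_fin mulrCA divff ?mulr1// gt_eqF.
Qed.

End LowerBound.

(** * Upper bound for the dimension *)

Section UpperBound.
Context {R : realType} {s : nat} (q p : 'I_s -> nat -> R).
Hypothesis hq : is_Qstar_matrix q.
Hypothesis hp0 : forall i k, 0 <= p i k.
Hypothesis hp1 : forall k, \sum_(i < s) p i k = 1.
Hypothesis hS : forall delta : R, 0 < delta -> (fineness q delta < +oo)%E.
Variable i0 : 'I_s.

Let M n := \prod_(k < n) qmax q k.

Definition word_cylinder (w : seq 'I_s) : set R :=
  cylinder q (nth i0 w) (size w).

Definition heavy_words (r : R) (n : nat) : set (seq 'I_s) :=
  [set w | size w = n /\ cylinder_length q (nth i0 w) n `^ r <=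
    cylinder_length p (nth i0 w) n].

Definition heavy_words_from (r : R) (N : nat) : set (seq 'I_s) :=
  \bigcup_(n in [set n | (N <= n)%N]) heavy_words r n.

(** The upper limit of the heavy cylinders; it is intersected with [[0, 1]],
    where the dimension of a distribution requires its sets to lie. *)
Definition heavy_points (r : R) : set R :=
  `[0, 1] `&` \bigcap_N \bigcup_(w in heavy_words_from r N) word_cylinder w.

Lemma measurable_heavy_points r : measurable (heavy_points r).
Proof.
apply: measurableI => //; apply: bigcap_measurable => // N _.
rewrite (_ : \bigcup_(w in _) _ = \bigcup_(w : seq 'I_s)
    (if w \in heavy_words_from r N then word_cylinder w else set0)); last first.
  apply/seteqP; split => x [w].
    by move=> hw xw; exists w => //; rewrite mem_set.
  by move=> _; case: ifPn => [/set_mem|//] hw xw; exists w.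
apply: countable_bigcupT_measurable => // w; case: ifPn => // _.
exact: measurable_itv.
Qed.

(** Within one rank, a heavy word satisfies
    [length `^ a <= mass * M n `^ (a - r)], and masses add up to [1]. *)
Lemma heavy_words_le (a r : R) n : 0 <= a -> r < a ->
  (\esum_(w in heavy_words r n) diameter_pow a (word_cylinder w) <=
    (M n `^ (a - r))%:E)%E.
Proof.
move=> a0 ra.
pose S : {pred n.-tuple 'I_s} := [pred w : n.-tuple 'I_s |
  cylinder_length q (nth i0 w) n `^ r <= cylinder_length p (nth i0 w) n].
rewrite (_ : heavy_words r n = [set val w | w in [set` S]]); last first.
  apply/seteqP; split => w.
    by move=> [wn hw]; exists (Tuple (introT eqP wn)).
  by move=> [u Su <-]; split; [exact: size_tuple|exact: Su].
rewrite esum_image; last by move=> u w _ _ /val_inj.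
rewrite esum_fset//; last by move=> w _; exact: diameter_pow_ge0.
rewrite -(bigfs _ (index_enum_uniq _)); last first.
  by move=> w _; rewrite mem_index_enum.
apply: (@le_trans _ _ (\sum_(w : n.-tuple 'I_s)
    (M n `^ (a - r) * cylinder_length p (nth i0 w) n)%:E)%E); last first.
  by rewrite sumEFin -mulr_sumr (sum_cylinder_length i0 n hp1) mulr1.
rewrite big_mkcond/=; apply: lee_sum => w _; case: ifPn => [Sw|_]; last first.
  by rewrite lee_fin mulr_ge0 ?powR_ge0// prodr_ge0.
have L0 := Qstar_length_gt0 hq (nth i0 w) n.
rewrite /word_cylinder size_tuple; apply: le_trans (diameter_pow_itv_le _ _ _) _ => //.
  exact: ltW.
rewrite lee_fin; set L := cylinder_length q _ _ in L0 *.
have -> : L `^ a = L `^ (a - r) * L `^ r.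
  by rewrite -powRD ?subrK// (gt_eqF L0) implybT.
rewrite ler_pM ?powR_ge0//.
rewrite ge0_ler_powR ?nnegrE ?subr_ge0 ?(ltW ra) ?(ltW L0)//; last first.
  exact: cylinder_length_le_qmax.
by apply: (le_trans (ltW L0)); exact: cylinder_length_le_qmax.
Qed.

Lemma heavy_words_from_le (a r : R) N : 0 <= a -> r < a ->
  (\esum_(w in heavy_words_from r N) diameter_pow a (word_cylinder w) <=
    \sum_(N <= n <oo) (M n `^ (a - r))%:E)%E.
Proof.
move=> a0 ra; rewrite esum_bigcupT; last 2 first.
- by move=> m n _ _ [w [[<- _] [<- _]]].
- by move=> w; exact: diameter_pow_ge0.
rewrite eseries_cond nneseries_esum; last by move=> n _; rewrite lee_fin powR_ge0.
by apply: le_esum => n _; exact: heavy_words_le.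
Qed.

Lemma hausdorff_measure_heavy_points (a r : R) : 0 <= a -> r < a ->
  hausdorff_measure a (heavy_points r) = 0%E.
Proof.
move=> a0 ra; apply: (@hausdorff_measure_eq0 _ _ word_cylinder) => e eps e0 eps0.
have ar0 : 0 < a - r by rewrite subr_gt0.
have [_ _ M0] := hq.
have /cvgrPdist_le/(_ _ e0)[N1 _ hN1] := M0.
have [N2 _ hN2] := nneseries_tail_cvg (P := predT)
  (qmax_prod_powR_summable hS ar0) (fun k _ => powR_ge0 _ _)
  (open_ereal_lt' (eps0 : (0 < eps%:E)%E)).
exists (heavy_words_from r (maxn N1 N2)); split.
- move=> w [n /= + [wn _]]; rewrite -wn geq_max => /andP[N1w _].
  apply: le_trans (diameter_itv_le _ _) _; rewrite lee_fin.
  apply: le_trans (cylinder_length_le_qmax hq _ _) _.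
  by have := hN1 _ N1w; rewrite /= sub0r normrN; apply: le_trans; exact: ler_norm.
- by move=> x [_ hx]; exact: hx.
- apply: le_trans (heavy_words_from_le _ a0 ra) _.
  by apply: ltW; apply: hN2; rewrite /= leq_maxr.
Qed.

Context {d : measure_display} {T : measurableType d} (P : probability T R).
Context (xi : nat -> T -> 'I_s).
Hypothesis hxi : forall k, discrete_RV (xi k).

(** A point belongs to its own cylinders, so that it is enough for these to be
    heavy infinitely often. *)
Lemma heavy_points_full r :
  {ae P, forall t, forall N, exists2 n, (N <= n)%N &
    cylinder_length q (xi ^~ t) n `^ r <= cylinder_length p (xi ^~ t) n} ->
  P ((fun t => Qstar_point q (xi ^~ t)) @^-1` heavy_points r) = 1%E.
Proof.
move=> [B [mB B0 hB]].
have mE : measurable ((fun t => Qstar_point q (xi ^~ t)) @^-1` heavy_points r).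
  rewrite -[X in measurable X]setTI; apply: (measurable_Qstar_point hq hxi) => //.
  exact: measurable_heavy_points.
apply/eqP; rewrite eq_le probability_le1//=.
have PB : P (~` B) = 1%E by rewrite probability_setC// B0 sube0.
rewrite -PB; apply: le_measure; rewrite ?inE//; first exact: measurableC.
move=> t Bt; split.
  have := Qstar_pointP (xi ^~ t) 0 hq.
  by rewrite /cylinder /cylinder_length/= big_ord0 add0r.
move=> N _; have [n Nn hn] : exists2 n, (N <= n)%N &
    cylinder_length q (xi ^~ t) n `^ r <= cylinder_length p (xi ^~ t) n.
  by move: N; apply: contrapT => h; apply: Bt; exact: hB.
have E k : (k < n)%N -> nth i0 (digits xi n t) k = xi k t by exact: nth_digits.
exists (digits xi n t).
  exists n => //; split; first exact: size_digits.
  by rewrite (eq_cylinder_length q E) (eq_cylinder_length p E).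
rewrite /word_cylinder size_digits (eq_cylinder q E).
exact: Qstar_pointP.
Qed.

End UpperBound.

(** * The dimension of the distribution *)

Lemma entropy_ratio_ge0 (R : realType) (s : nat) (p q : 'I_s -> nat -> R) n :
  (forall i k, 0 <= p i k) -> (forall k, \sum_(i < s) p i k = 1) ->
  (forall i k, 0 <= q i k) -> (forall k, \sum_(i < s) q i k = 1) ->
  0 <= sum_entropy p n / sum_cross_entropy p q n.
Proof.
move=> p0 p1 q0 q1.
have cross_ge0 (u : 'I_s -> nat -> R) k : (forall i, u i k <= 1) ->
    0 <= - \sum_(i < s) p i k * ln (u i k).
  move=> u1; rewrite oppr_ge0 sumr_le0// => i _.
  by rewrite mulr_ge0_le0// ln_le0.
by rewrite divr_ge0// sumr_ge0// => k _; apply: cross_ge0 => i; exact: le1_prob.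
Qed.

Theorem theorem3p1 (R : realType) (s : nat) (hs : (2 <= s)%N)
    (q : 'I_s -> nat -> R) (hq : is_Qstar_matrix q)
    (p : 'I_s -> nat -> R)
    (hp0 : forall i k, 0 <= p i k)
    (hp1 : forall k, \sum_(i < s) p i k = 1)
    (d : measure_display) (T : measurableType d) (P : probability T R)
    (xi : nat -> T -> 'I_s)
    (hxi : forall k, discrete_RV (xi k))
    (hxi_indep : independent_discrete_RVs P xi)
    (hxi_dist : forall k i, P (xi k @^-1` [set i]) = (p i k)%:E)
    (hS : forall delta : R, 0 < delta -> (fineness q delta < +oo)%E)
    (hd : (\sum_(j <oo) (log_variance p q j / j.+1%:R ^+ 2)%:E < +oo)%E)
    (hB : (0 < limn_einf (fun n => (sum_cross_entropy p q n / n%:R)%:E))%E) :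
  hausdorff_dim_distribution (distribution P (Qstar_RV P hq hxi)) =
  limn_einf (fun n => (sum_entropy p n / sum_cross_entropy p q n)%:E).
Proof.
pose i0 : 'I_s := Ordinal (ltnW hs).
set D := limn_einf _.
have D_ge0 : (0 <= D)%E.
  rewrite leNgt; apply/negP => /limn_einf_lt/(_ 0%N)[n _].
  have [q0 q1 _] := hq.
  by rewrite lte_fin ltNge entropy_ratio_ge0// => i k; exact: ltW.
apply/eqP; rewrite eq_le; apply/andP; split.
- have dim_le (r e : R) : D = r%:E -> 0 < e ->
      (hausdorff_dim_distribution (distribution P (Qstar_RV P hq hxi)) <=
        (r + e)%:E)%E.
    move=> Dr e0; have r0 : 0 <= r by rewrite -lee_fin -Dr.
    have re0 : 0 <= r + e by rewrite addr_ge0// ltW.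
    have re2 : r + e / 2 < r + e by lra.
    have Dre : (D < (r + e / 2)%:E)%E by rewrite Dr lte_fin; lra.
    have typ := ae_mass_ge hq hp0 hp1 hB hxi hxi_indep hxi_dist hd i0 Dre.
    have full := heavy_points_full hq i0 hxi typ.
    have H0 := hausdorff_measure_heavy_points hq hp0 hp1 hS i0 re0 re2.
    apply: (@le_trans _ _ (hausdorff_dim (heavy_points q p i0 (r + e / 2)))).
      apply: ereal_inf_lbound; exists (heavy_points q p i0 (r + e / 2)) => //.
      split; [exact: measurable_heavy_points|exact: subIsetl|exact: full].
    by apply: ereal_inf_lbound; exists (r + e).
  case DE : D D_ge0 => [r| |]// _; last by rewrite leey.
  by apply/lee_addgt0Pr => e e0; rewrite -EFinD; exact: dim_le.
- apply: le_ereal_inf_tmp => _ [E [mE _ PE] <-].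
  apply: le_ereal_inf_tmp => _ [alpha [alpha0 H0] <-].
  rewrite leNgt; apply/negP => alphaD.
  have [r alphar rD] : exists2 r : R, alpha < r & (r%:E < D)%E.
    case: (D) alphaD => [x| |]//; rewrite ?lte_fin.
      by move=> ?; exists ((alpha + x) / 2); rewrite ?lte_fin; lra.
    by move=> _; exists (alpha + 1); [lra|rewrite ltry].
  have typ := ae_mass_le hq hp0 hp1 hB hxi hxi_indep hxi_dist hd i0 rD.
  have /eqP := H0; apply/negP.
  apply: (hausdorff_measure_neq0 hq hp0 hp1 hxi hxi_indep hxi_dist hS i0 _ typ mE PE).
  by rewrite alpha0.
Qed.
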